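(* Let $A=\mathbb{R}/\mathbb{Z}\times[0,1]$ and let $f:A\to A$ be a $C^1$ diffeomorphism mapping each boundary component of $A$ to itself. If $f$ is a twist map admitting a positive integral invariant, then $f$ has at least two fixed points.
   Context: $A=\mathbb{R}/\mathbb{Z}\times[0,1]$ is the standard annulus, with $x$ the $1$-periodic coordinate and $y$ the radial coordinate; its universal cover is $\widetilde A=\mathbb{R}\times[0,1]$. Its boundary components are $\mathbb{R}/\mathbb{Z}\times\{0\}$ and $\mathbb{R}/\mathbb{Z}\times\{1\}$. Twist map: let $\widetilde f:\widetilde A\to\widetilde A$ be a lift of $f$ to the universal cover, and write $\widetilde f(x,y)=(\tilde f_1(x,y),\tilde f_2(x,y))$. The map $\widetilde f$ is called a twist map if the two conditions $\tilde f_1(x,0)-\tilde f_1(0,0)<x$ and $\tilde f_1(x,1)-\tilde f_1(0,1)>x$ are satisfied for all $x\in\mathbb{R}$. This is independent of the choice of lift and, by periodicity, only needs to be checked for $x\in[0,1]$. The map $f$ is also called a twist map if $\widetilde f$ is a twist map. Positive integral invariant: $f$ admits a positive integral invariant if there exists a function $d\mu:A\to\mathbb{R}$ such that $d\mu>0$ at almost every point of $A$ and the measure associated with $d\mu$ (that is, having $d\mu$ as its density), namely $\mu(U)=\int_U d\mu$, satisfies $\mu(U)=\mu(f(U))$ for all measurable $U\subseteq A$.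
   Formalization: The twist condition as given reads 0 < 0 at x = 0, so it is replaced by the classical one: some lift satisfies f_1(x,0) < x < f_1(x,1) for all x. The density dμ is required to be integrable on A, since with infinite total mass the theorem fails. *)

(* Defs.v *)
From HB Require Import structures.
From mathcomp Require Import all_boot all_order all_algebra.
From mathcomp Require Import all_classical all_reals all_analysis.

Set Implicit Arguments.
Unset Strict Implicit.
Unset Printing Implicit Defensive.

Import Order.TTheory GRing.Theory Num.Theory.
Import numFieldNormedType.Exports.

Local Open Scope classical_set_scope.
Local Open Scope ring_scope.
Local Open Scope quotient_scope.

Section circle.
Variable R : realType.

Definition circle_rel : rel R := fun x y => (x - y) \is a Num.int.

Let circle_rel_refl : reflexive circle_rel.
Proof. by move=> x; rewrite /circle_rel subrr. Qed.

Let circle_rel_sym : symmetric circle_rel.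
Proof. by move=> x y; rewrite /circle_rel -opprB rpredN. Qed.

Let circle_rel_trans : transitive circle_rel.
Proof.
by move=> y x z xy yz; rewrite /circle_rel -(subrKA y x (- z)) rpredD.
Qed.

Canonical circle_equiv : equiv_rel R :=
  EquivRel circle_rel circle_rel_refl circle_rel_sym circle_rel_trans.

Definition circle : Type := {eq_quot circle_equiv}.

HB.instance Definition _ := Quotient.on circle.
HB.instance Definition _ := Choice.on circle.
HB.instance Definition _ := isPointed.Build circle (\pi_circle 0).

Definition circle_proj (x : R) : circle := \pi_circle x.

Lemma circle_projP (x y : R) :
  circle_proj x = circle_proj y <-> (x - y) \is a Num.int.
Proof.
by split=> [/eqP|xy]; [|apply/eqP]; rewrite /circle_proj eqmodE.
Qed.

(* The quotient sigma-algebra: U is measurable iff its preimage in R is Borel. *)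
Definition circle_measurable : set (set circle) :=
  [set U | measurable (circle_proj @^-1` U : set (measurableTypeR R))].

Let circle_measurable0 : circle_measurable set0.
Proof. by rewrite /circle_measurable /= preimage_set0; exact: measurable0. Qed.

Let circle_measurableC U : circle_measurable U -> circle_measurable (~` U).
Proof. by rewrite /circle_measurable /= preimage_setC; exact: measurableC. Qed.

Let circle_measurable_bigcup (F : (set circle)^nat) :
  (forall i, circle_measurable (F i)) -> circle_measurable (\bigcup_i F i).
Proof.
move=> mF; rewrite /circle_measurable /= preimage_bigcup.
by apply: bigcupT_measurable => i; exact: mF.
Qed.

Definition circle_display : measure_display. Proof. by []. Qed.

HB.instance Definition _ := isMeasurable.Build circle_display circle
  circle_measurable0 circle_measurableC circle_measurable_bigcup.

Lemma measurable_circle_proj :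
  measurable_fun setT (circle_proj : measurableTypeR R -> circle).
Proof. by move=> _ U mU; rewrite setTI. Qed.

End circle.
Arguments circle_proj {R} x.

(* The arc length measure on R/Z: Lebesgue measure on the fundamental domain
   [0, 1[, pushed forward by the projection. *)
Definition circle_measure (R : realType) (U : set (circle R)) : \bar R :=
  lebesgue_measure
    ((@circle_proj R @^-1` U) `&` `[0, 1[ : set (measurableTypeR R)).

Section circle_measure_is_measure.
Variable R : realType.

Let mrestr_lebesgue :=
  mrestr (@lebesgue_measure R) (measurable_itv `[(0 : R), 1[).

Let circle_measureE :
  @circle_measure R = pushforward mrestr_lebesgue
    (@circle_proj R : measurableTypeR R -> circle R).
Proof. by []. Qed.

Let circle_measure0 : @circle_measure R set0 = 0%E.
Proof. by rewrite /circle_measure preimage_set0 set0I measure0. Qed.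

Let circle_measure_ge0 U : (0 <= @circle_measure R U)%E.
Proof. exact: outer_measure_ge0. Qed.

Let circle_measure_sigma_additive : semi_sigma_additive (@circle_measure R).
Proof.
move=> F mF tF mUF; rewrite circle_measureE.
rewrite /pushforward preimage_bigcup.
have mproj (U : set (circle R)) : measurable U -> measurable (circle_proj @^-1` U :
    set (measurableTypeR R)) by [].
apply: measure_semi_sigma_additive.
- by move=> n; exact: mproj.
- apply/trivIsetP => /= i j _ _ ij; rewrite -preimage_setI.
  by move/trivIsetP : tF => /(_ _ _ _ _ ij) ->//; rewrite preimage_set0.
- by rewrite -preimage_bigcup; exact: mproj.
Qed.

HB.instance Definition _ := isMeasure.Build _ (circle R) R (@circle_measure R)
  circle_measure0 circle_measure_ge0 circle_measure_sigma_additive.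

End circle_measure_is_measure.

Section annulus.
Variable R : realType.

(* The ambient product types R/Z * R and R * R are used for points; only the
   values of maps on [annulus], resp. [strip], matter below. *)
Definition annulus : set (circle R * R) := [set p | 0 <= p.2 <= 1].

Definition strip : set (R * R) := [set p | 0 <= p.2 <= 1].

Definition boundary (b : R) : set (circle R * R) := [set p | p.2 = b].

Definition annulus_proj (p : R * R) : circle R * R := (circle_proj p.1, p.2).

Definition C1_open (U : set (R * R)) (G : R * R -> R * R) :=
  (forall p, U p -> differentiable G p) /\
  (forall v : R * R, {within U, continuous (fun p => 'd G p v)}).

(* C^1 in the charts of the annulus, which are the local inverses of
   [annulus_proj]; at the boundary, C^1 means, as usual, having a C^1 extension
   to a neighbourhood in the plane. *)
Definition C1_annulus (f : circle R * R -> circle R * R) :=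
  forall p, strip p -> exists (U : set (R * R)) (G : R * R -> R * R),
    [/\ open U, U p, C1_open U G &
        forall q, U q -> strip q -> annulus_proj (G q) = f (annulus_proj q)].

Definition C1_diffeo_annulus (f : circle R * R -> circle R * R) :=
  exists g : circle R * R -> circle R * R,
    [/\ set_fun annulus annulus f, set_fun annulus annulus g,
        forall p, annulus p -> g (f p) = p /\ f (g p) = p,
        C1_annulus f & C1_annulus g].

Definition is_lift (f : circle R * R -> circle R * R) (F : R * R -> R * R) :=
  [/\ set_fun strip strip F, {within strip, continuous F} &
      forall p, strip p -> annulus_proj (F p) = f (annulus_proj p)].

(* The boundary twist condition of Poincare and Birkhoff: the lift moves the
   bottom boundary line to the left and the top one to the right. The variant
   F_1(x, 0) - F_1(0, 0) < x, F_1(x, 1) - F_1(0, 1) > x for all x, sometimes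
   given as the definition, is unsatisfiable: at x = 0 it reads 0 < 0. *)
Definition twist_lift (F : R * R -> R * R) :=
  forall x : R, (F (x, 0)).1 < x /\ x < (F (x, 1)).1.

(* The twist condition singles out one lift of f, hence the existential. *)
Definition twist_map (f : circle R * R -> circle R * R) :=
  exists2 F, is_lift f F & twist_lift F.

Definition annulus_measure : set (circle R * measurableTypeR R) -> \bar R :=
  (@circle_measure R \x @lebesgue_measure R)%E.
HB.instance Definition _ := Measure.on annulus_measure.

(* The density is integrable, so that the integral over every measurable set is
   a real number. Without this finiteness the twist theorem fails: a map that
   pushes all interior points towards one boundary component preserves a
   positive density of infinite mass. *)
Definition positive_integral_invariant (f : circle R * R -> circle R * R)
    (dmu : circle R * R -> R) :=
  [/\ annulus_measure.-integrable annulus (EFin \o dmu),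
      {ae annulus_measure, forall p, annulus p -> 0 < dmu p} &
      forall U : set (circle R * measurableTypeR R),
        measurable U -> U `<=` annulus ->
        (\int[annulus_measure]_(p in U) (dmu p)%:E =
         \int[annulus_measure]_(p in f @` U) (dmu p)%:E)%E].

End annulus.

(* Main.v *)
Require Import Defs.
From mathcomp Require Import all_boot all_order all_algebra.
From mathcomp Require Import all_classical all_reals all_analysis.
From mathcomp Require Import ring lra zify.

Set Implicit Arguments.
Unset Strict Implicit.
Unset Printing Implicit Defensive.

Import Order.TTheory GRing.Theory Num.Theory.
Import numFieldNormedType.Exports.

Local Open Scope classical_set_scope.
Local Open Scope ring_scope.

(** Suppose that [f] has at most one fixed point. By continuity and the twist
    condition a lift of [f] commutes with the unit translation [lift_degree]; it
    extends to a homeomorphism [h] of the plane that moves the points below the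
    strip to the left and those above it to the right [extension]. Its
    displacement field [V p = h p - p] is horizontal on the two boundary lines,
    where it points to the left (bottom) and to the right (top), and it vanishes
    at most on the integer translates of one point. The proof compares how much
    the angle of [V] turns along arcs that cross the strip from bottom to top.

    All arcs avoiding the zeros give the same turn [arc_final_angle_unique]. One
    angle function of [V] is lifted from the bottom line along vertical segments,
    another one from the top line; between two consecutive zeros they differ by a
    constant, and by periodicity this is the same constant on both sides of each
    zero. So the two functions glue to an angle function off the zeros, whose
    values on the bottom and on the top line are constant.

    Some arc turns [V] from [pi] to [0], through the upward direction
    [turning_arc]; this is the idea of Birkhoff, in the form given by Brown and
    Neumann. Since [h] preserves a finite measure with positive density, it maps no
    open periodic set into itself with a gap [nondissipative_of_invariant].
    Therefore the points reached from the bottom by iterating [h] and jumping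
    upwards a little after each step extend to the top [reach_top]. In a shortest
    such pseudo-orbit the jumps on a common vertical line preserve the order
    [good_orbit], and all of them are realised at once by a small vertical push,
    increasing on each vertical line [vertical_push]. Composing [h] with the push
    yields an injective map [G] close to [h] which lifts the bottom line by a
    positive constant. An arc from a bottom point to its image, chosen through the
    start of the pseudo-orbit and continued by its images under [G], is a path [g]
    that never comes back to a point it left one time unit or more before
    [orbit_path], and it climbs above the top. The chord from [g s] to
    [g (s + 1)], which is the displacement of [G] and nearly that of [h], can be
    deformed without vanishing to a chord from the lowest point [g 0], and finally
    to a chord to the highest point of the path; as those chords point upwards,
    the angle starts at [pi], stays in [0, pi] at both ends and finishes at [0]
    [chord_angle].

    The inverse of [h], reflected in a vertical line, satisfies the same
    hypotheses, and its arc becomes an arc along which [V] turns from [pi] to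
    [2 * pi]. This contradicts the uniqueness of the turn
    [single_fixed_point_absurd]. *)

(** * Continuity, compactness, periodicity *)

(** Continuity at a point, kept folded so that [ctn_tac] can recurse on the shape
    of the function. *)
Definition ctn (T U : topologicalType) (f : T -> U) (x : T) :=
  {for x, continuous f}.

Section ContinuityRules.
Variables (R : realType) (T : topologicalType).
Implicit Types (f g : T -> R) (x : T).

Lemma ctn_id x : ctn (fun t : T => t) x.
Proof. exact: cvg_id. Qed.

Lemma ctn_cst (U : topologicalType) (c : U) x : ctn (fun=> c) x.
Proof. exact: cvg_cst. Qed.

Lemma ctnD f g x : ctn f x -> ctn g x -> ctn (fun t => f t + g t) x.
Proof. exact: cvgD. Qed.

Lemma ctnN f x : ctn f x -> ctn (fun t => - f t) x.
Proof. exact: cvgN. Qed.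

Lemma ctnM f g x : ctn f x -> ctn g x -> ctn (fun t => f t * g t) x.
Proof. exact: cvgM. Qed.

Lemma ctnV f x : f x != 0 -> ctn f x -> ctn (fun t => (f t)^-1) x.
Proof. exact: cvgV. Qed.

Lemma ctn_norm f x : ctn f x -> ctn (fun t => `|f t|) x.
Proof. exact: cvg_norm. Qed.

Lemma ctn_min f g x :
  ctn f x -> ctn g x -> ctn (fun t => Num.min (f t) (g t)) x.
Proof. exact: continuous_min. Qed.

Lemma ctn_max f g x :
  ctn f x -> ctn g x -> ctn (fun t => Num.max (f t) (g t)) x.
Proof. exact: continuous_max. Qed.

Lemma ctn_comp (U W : topologicalType) (f : T -> U) (g : U -> W) x :
  ctn g (f x) -> ctn f x -> ctn (fun t => g (f t)) x.
Proof. by move=> cg cf; exact: (@continuous_comp _ _ _ f g). Qed.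

Lemma ctn_pair (U W : topologicalType) (f : T -> U) (g : T -> W) x :
  ctn f x -> ctn g x -> ctn (fun t => (f t, g t)) x.
Proof. exact: cvg_pair. Qed.

Lemma ctn_fst (U W : topologicalType) (f : T -> U * W) x :
  ctn f x -> ctn (fun t => (f t).1) x.
Proof. by move=> cf; apply: ctn_comp cf; exact: cvg_fst. Qed.

Lemma ctn_snd (U W : topologicalType) (f : T -> U * W) x :
  ctn f x -> ctn (fun t => (f t).2) x.
Proof. by move=> cf; apply: ctn_comp cf; exact: cvg_snd. Qed.

Lemma ctn_ext (U : topologicalType) (f g : T -> U) x :
  f =1 g -> ctn f x -> ctn g x.
Proof. by move=> /funext ->. Qed.

Lemma ctn_sum n (f : nat -> T -> R) x :
  (forall i, (i < n)%N -> ctn (f i) x) ->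
  ctn (fun t => \sum_(i < n) f i t) x.
Proof.
elim: n => [|n IH] cf.
  by apply: (@ctn_ext _ (fun=> 0)) => [t|]; [rewrite big_ord0|exact: ctn_cst].
apply: (@ctn_ext _ (fun t => \sum_(i < n) f i t + f n t)) => [t|].
  by rewrite big_ord_recr.
by apply: ctnD; [apply: IH => i /ltnW; exact: cf|exact: cf].
Qed.

Lemma ctn_near (U : topologicalType) (f g : T -> U) x :
  (\forall t \near x, f t = g t) -> ctn f x -> ctn g x.
Proof.
move=> fg cf; rewrite /ctn /prop_for /continuous_at -(nbhs_singleton fg).
by apply: cvg_trans cf; exact: near_eq_cvg.
Qed.

End ContinuityRules.

Ltac ctn_tac :=
  lazymatch goal with
  | |- ctn (fun t => t) _ => exact: ctn_id
  | |- ctn (fun _ => ?c) _ => exact: ctn_cst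
  | |- ctn (fun t => @?f t + @?g t) _ => apply: (@ctnD _ _ f g); ctn_tac
  | |- ctn (fun t => - @?f t) _ => apply: (@ctnN _ _ f); ctn_tac
  | |- ctn (fun t => @?f t * @?g t) _ => apply: (@ctnM _ _ f g); ctn_tac
  | |- ctn (fun t => `|@?f t|) _ => apply: (@ctn_norm _ _ f); ctn_tac
  | |- ctn (fun t => Num.min (@?f t) (@?g t)) _ =>
      apply: (@ctn_min _ _ f g); ctn_tac
  | |- ctn (fun t => Num.max (@?f t) (@?g t)) _ =>
      apply: (@ctn_max _ _ f g); ctn_tac
  | |- ctn (fun t => (@?f t, @?g t)) _ => apply: (@ctn_pair _ _ _ f g); ctn_tac
  | |- ctn (fun t => (@?f t).1) _ => apply: (@ctn_fst _ _ _ f); ctn_tac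
  | |- ctn (fun t => (@?f t).2) _ => apply: (@ctn_snd _ _ _ f); ctn_tac
  | |- ctn (fun t => ?h (@?f t)) _ =>
      apply: (@ctn_comp _ _ _ f h); [try by [] | ctn_tac]
  | |- ctn fst _ => exact: cvg_fst
  | |- ctn snd _ => exact: cvg_snd
  | |- _ => try by []
  end.

Section Compactness.
Variable R : realType.

Lemma compact_positive_bound (T : topologicalType) (A : set T) (f : T -> R) :
  compact A -> (forall x, ctn f x) -> (forall x, A x -> 0 < f x) ->
  exists2 m, 0 < m & forall x, A x -> m <= f x.
Proof.
move=> cA cf fpos; have [A0|/set0P/negP] := pselect (A !=set0); last first.
  by rewrite negbK => /eqP ->; exists 1.
have [|c] := @compact_EVT_min _ R f A A0 cA; first exact: continuous_subspaceT.
rewrite inE => Ac fc; exists (f c); first exact: fpos.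
by move=> x Ax; apply: fc; rewrite inE.
Qed.

Definition strip_box (a b : R) : set (R * R) := [set p | a <= p.1 <= b /\ 0 <= p.2 <= 1].

Lemma compact_strip_box a b : compact (strip_box a b).
Proof.
have -> : strip_box a b = `[a, b] `*` `[0, 1].
  by apply/seteqP; split=> -[x y] /=; rewrite !in_itv.
by apply: compact_setX; exact: segment_compact.
Qed.

Lemma closed_le_ctn (T : topologicalType) (f g : T -> R) :
  (forall x, ctn f x) -> (forall x, ctn g x) -> closed [set x | f x <= g x].
Proof.
move=> cf cg.
have -> : [set x | f x <= g x] = (fun x => g x - f x) @^-1` [set y | 0 <= y].
  by apply/seteqP; split=> x /=; rewrite subr_ge0.
apply: closed_comp; last exact: closed_ge.
by move=> x _; apply: (ctnD (cg x)); exact: (ctnN (cf x)).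
Qed.

Lemma open_lt_ctn (T : topologicalType) (f g : T -> R) :
  (forall x, ctn f x) -> (forall x, ctn g x) -> open [set x | f x < g x].
Proof.
move=> cf cg; have := closed_le_ctn cg cf; rewrite -openC; congr open.
by apply/seteqP; split=> x /=; rewrite real_ltNge ?num_real// => /negP.
Qed.

Lemma near_lt_ctn (T : topologicalType) (f g : T -> R) x :
  ctn f x -> ctn g x -> f x < g x -> \forall t \near x, f t < g t.
Proof.
move=> cf cg fg.
have cfg : ctn (fun t => g t - f t) x by apply: ctnD => //; apply: ctnN.
have P : nbhs (g x - f x) [set y | 0 < y].
  by apply: open_nbhs_nbhs; split; [exact: open_gt|rewrite /= subr_gt0].
have Q : nbhs x [set t | 0 < g t - f t] := cfg _ P.
by apply: filterS Q => t /=; rewrite subr_gt0.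
Qed.

End Compactness.

Section Periodicity.
Variable R : realType.

Lemma int_periodic (T : Type) (f : R -> T) : (forall x, f (x + 1) = f x) ->
  forall (m : int) x, f (x + m%:~R) = f x.
Proof.
move=> fp; have fn (n : nat) x : f (x + n%:R) = f x.
  by elim: n x => [|n IH] x; rewrite ?addr0// -natr1 addrA fp IH.
case=> n x; first by rewrite -pmulrn fn.
by rewrite -[in RHS](subrK n.+1%:R x) fn NegzE mulrNz -pmulrn.
Qed.

Lemma to_fundamental (x0 x : R) : exists m : int, x0 <= x + m%:~R <= x0 + 1.
Proof.
exists (- Num.floor (x - x0)); rewrite mulrNz.
have := floor_le_tmp (x - x0); have := floorD1_gt (x - x0).
by rewrite intrD => h1 h2; apply/andP; split; lra.
Qed.

End Periodicity.

(** * Angles of plane vectors *)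

Section Angles.
Variable R : realType.
Implicit Types (u v : R * R) (a b : R).

Definition dot u v := u.1 * v.1 + u.2 * v.2.
Definition cross u v := u.1 * v.2 - u.2 * v.1.

(** The signed angle from [u] to [v], provided that it is less than a quarter
    turn. *)
Definition turn u v := atan (cross u v / dot u v).

Definition arg_of v a := exists2 r, 0 < r & v = (r * cos a, r * sin a).

Lemma turn_gt u v : - (pi / 2) < turn u v.
Proof. exact: atan_gtNpi2. Qed.

Lemma turn_lt u v : turn u v < pi / 2.
Proof. exact: atan_ltpi2. Qed.

Lemma turn_refl v : turn v v = 0.
Proof. by rewrite /turn (_ : cross v v = 0) ?mul0r ?atan0 // /cross; ring. Qed.

Lemma dot_refl_gt0 v : v != 0 -> 0 < dot v v.
Proof.
move=> v0; have := addr_ge0 (sqr_ge0 v.1) (sqr_ge0 v.2).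
rewrite le_eqVlt eq_sym paddr_eq0 ?sqr_ge0// !sqrf_eq0 /dot !expr2.
by case/orP=> // /andP[/eqP e1 /eqP e2]; case/eqP: v0; case: v e1 e2 => ? ? /= -> ->.
Qed.

Lemma dotC (u v : R * R) : dot u v = dot v u.
Proof. by rewrite /dot mulrC [u.2 * _]mulrC. Qed.

Lemma arg_of_turn u v a :
  arg_of u a -> 0 < dot u v -> arg_of v (a + turn u v).
Proof.
move=> [r r0 uE] duv; set b := turn u v.
have cb : 0 < cos b by apply: cos_gt0_pihalf; rewrite turn_gt turn_lt.
have d0 : dot u v != 0 by rewrite gt_eqF.
have sb : sin b = cos b * (cross u v / dot u v).
  have := atanK (cross u v / dot u v); rewrite -/(turn u v) -/b /tan => <-.
  by rewrite mulrCA divff ?mulr1// gt_eqF.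
exists (dot u v / (r * cos b)); first by rewrite divr_gt0// mulr_gt0.
have cs := cos2Dsin2 a.
rewrite cosD sinD sb; move: d0; rewrite uE /dot /cross /= => d0.
have r0' : r != 0 by rewrite gt_eqF.
have cb0 : cos b != 0 by rewrite gt_eqF.
apply: injective_projections => /=.
- transitivity (v.1 * (cos a ^+ 2 + sin a ^+ 2)); first by rewrite cs mulr1.
  by field; rewrite r0' cb0 d0.
- transitivity (v.2 * (cos a ^+ 2 + sin a ^+ 2)); first by rewrite cs mulr1.
  by field; rewrite r0' cb0 d0.
Qed.

Lemma arg_of_neq0 v a : arg_of v a -> v != 0.
Proof.
move=> [r r0 ->]; apply/eqP => -[/eqP]; rewrite mulf_eq0 gt_eqF//= => /eqP c0 /eqP.
rewrite mulf_eq0 gt_eqF//= => /eqP s0; have := cos2Dsin2 a.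
by rewrite c0 s0 expr0n addr0 => /esym/eqP; rewrite oner_eq0.
Qed.

(** Two angles of a vector differ by a multiple of a full turn; in this form the
    multiple need not be named. *)
Lemma arg_of_cosB v a b : arg_of v a -> arg_of v b -> cos (a - b) = 1.
Proof.
move=> [r r0 ->] [s s0 [e1 e2]].
have rs : r = s.
  apply/eqP; rewrite -(@eqrXn2 _ 2) ?ltW//; apply/eqP.
  rewrite -[LHS]mulr1 -[RHS]mulr1 -{1}(cos2Dsin2 a) -(cos2Dsin2 b) !mulrDr -!exprMn.
  by rewrite e1 e2.
move: e1 e2; rewrite -rs => /mulfI; rewrite gt_eqF// => /(_ isT) ca.
move=> /mulfI; rewrite gt_eqF// => /(_ isT) sa.
by rewrite cosB ca sa -!expr2 cos2Dsin2.
Qed.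

Lemma arg_of_sum n (u : nat -> R * R) a :
  (forall k, (k < n)%N -> 0 < dot (u k) (u k.+1)) -> arg_of (u 0%N) a ->
  arg_of (u n) (a + \sum_(k < n) turn (u k) (u k.+1)).
Proof.
move=> du ua; elim: n du => [|n IH] du; first by rewrite big_ord0 addr0.
rewrite big_ord_recr /= addrA; apply: arg_of_turn; last exact: du.
by apply: IH => k kn; apply: du; rewrite ltnS ltnW.
Qed.

(** Adding to [v] an upward vector shorter than [v] keeps the angle between the
    two below a quarter turn. *)
Lemma chord_dot_gt0 (v : R * R) (s : R) : 0 <= s ->
  (0 < s -> s < Num.max `|v.1| `|v.2|) -> v + (0, s) != 0 ->
  0 < dot v (v + (0, s)).
Proof.
rewrite le_eqVlt => /predU1P[<- _|s0 /(_ s0) hs _].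
  have -> : v + (0, 0) = v by apply: injective_projections; rewrite /= addr0.
  exact: dot_refl_gt0.
rewrite /dot /= addr0; move: hs; rewrite lt_max => hs.
have [sv|sv] := ltP s `|v.2|.
  have : 0 < `|v.2| * (`|v.2| - s) by rewrite mulr_gt0 ?subr_gt0// (lt_trans s0).
  have : `|v.2| * `|v.2| = v.2 * v.2 by rewrite -normrM ger0_norm// -expr2 sqr_ge0.
  have : 0 <= (`|v.2| + v.2) * s.
    by rewrite mulr_ge0 ?(ltW s0)//; have := ler_norm (- v.2); rewrite normrN; lra.
  by have := sqr_ge0 v.1; rewrite expr2; nra.
have s1 : s < `|v.1| by move: hs; rewrite [s < `|v.2|]ltNge sv orbF.
have : 0 < (`|v.1| - s) * (`|v.1| + s) by rewrite mulr_gt0 ?subr_gt0 ?addr_gt0// (lt_trans s0).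
have : `|v.1| * `|v.1| = v.1 * v.1 by rewrite -normrM ger0_norm// -expr2 sqr_ge0.
have : 0 <= (s - `|v.2|) * s by rewrite mulr_ge0 ?(ltW s0)// subr_ge0.
have : 0 <= (`|v.2| + v.2) * s.
  by rewrite mulr_ge0 ?(ltW s0)//; have := ler_norm (- v.2); rewrite normrN; lra.
by have := sqr_ge0 v.2; rewrite expr2; nra.
Qed.

Lemma ctn_turn (T : topologicalType) (u v : T -> R * R) x :
  ctn u x -> ctn v x -> 0 < dot (u x) (v x) ->
  ctn (fun t => turn (u t) (v t)) x.
Proof.
move=> cu cv d0.
have cd : ctn (fun t => dot (u t) (v t)) x by rewrite /dot; ctn_tac.
apply: (@ctn_comp _ _ _ (fun t => cross (u t) (v t) / dot (u t) (v t)) atan).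
  exact: continuous_atan.
apply: ctnM; first by rewrite /cross; ctn_tac.
by apply: ctnV => //; rewrite gt_eqF.
Qed.

Lemma arg_of_shift (v : R * R) a c : arg_of v a -> cos c = 1 -> arg_of v (a + c).
Proof.
move=> [r r0 ->] c1; have s0 : sin c = 0 by apply: cos1sin0; rewrite c1 normr1.
by exists r => //; rewrite cosD sinD c1 s0 !mulr1 !mulr0 subr0 addr0.
Qed.

Lemma sin_eq0_small a : - (pi / 2) <= a <= pi / 2 -> sin a = 0 -> a = 0.
Proof.
have p0 : 0 < pi :> R := pi_gt0 R.
move=> ai; rewrite -[in RHS]sin0 => /(@sin_inj R a 0); apply; rewrite in_itv//=.
by apply/andP; split; lra.
Qed.

(** In the window of width [2 * pi] centred at [pi / 2], a horizontal vector has
    only one angle. *)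
Lemma arg_of_left v a : arg_of v a -> v.1 < 0 -> v.2 = 0 ->
  - (pi / 2) < a < 3 * (pi / 2) -> a = pi.
Proof.
move=> [r r0 ->] /=; rewrite pmulr_rlt0// => ca /eqP; rewrite mulf_eq0 gt_eqF//=.
move=> /eqP sa /andP[a1 a2].
have p0 : 0 < pi :> R := pi_gt0 R.
have [|a0] := ltP (pi / 2) a; last first.
  have := @cos_ge0_pihalf R a; rewrite (ltW a1) a0 => /(_ isT).
  by rewrite leNgt ca.
move=> a3; have sp : sin (a - pi) = 0 by rewrite sinB sinpi cospi sa; ring.
by apply/eqP; rewrite -subr_eq0; apply/eqP/sin_eq0_small => //; apply/andP;
  split; lra.
Qed.

Lemma arg_of_right v a : arg_of v a -> 0 < v.1 -> v.2 = 0 ->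
  - (pi / 2) < a < 3 * (pi / 2) -> a = 0.
Proof.
move=> [r r0 ->] /=; rewrite pmulr_rgt0// => ca /eqP; rewrite mulf_eq0 gt_eqF//=.
move=> /eqP sa /andP[a1 a2].
have p0 : 0 < pi :> R := pi_gt0 R.
have [a0|a0] := ltP (pi / 2) a.
  have : 0 <= cos (a - pi) by apply: cos_ge0_pihalf; apply/andP; split; lra.
  by rewrite cosB sinpi cospi sa; lra.
by apply: sin_eq0_small => //; apply/andP; split; lra.
Qed.

Lemma cos_int (m : int) : cos (2 * pi * m%:~R) = 1 :> R.
Proof.
have := @int_periodic R _ (fun x => cos (2 * pi * x)) _ m 0.
rewrite add0r mulr0 cos0; apply=> x.
by rewrite (_ : _ * _ = 2 * pi * x + pi *+ 2) ?cosD2pi// mulr2n; ring.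
Qed.

Lemma cos_eq1_int (x : R) : cos (2 * pi * x) = 1 -> exists m : int, x = m%:~R.
Proof.
have pp := pi_gt0 R.
have per := @int_periodic R _ (fun x => cos (2 * pi * x)).
pose w := x - (Num.floor x)%:~R.
have [w0 w1] : 0 <= w /\ w < 1.
  have := floor_le_tmp x; have := floorD1_gt x.
  by rewrite /w intrD => h1 h2; split; lra.
have xE : x = w + (Num.floor x)%:~R by rewrite subrK.
rewrite xE per; last first.
  by move=> u; rewrite (_ : _ * _ = 2 * pi * u + pi *+ 2) ?cosD2pi// mulr2n; ring.
move=> cw; suff w00 : w = 0 by exists (Num.floor x); rewrite w00 add0r.
have [wh|wh] := leP w (1 / 2).
  have : cos (2 * pi * w) = cos 0 by rewrite cw cos0.
  move=> /cos_inj; rewrite !in_itv/= lexx => h.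
  have : 2 * pi * w = 0.
    apply: h; last by rewrite ltW.
    by apply/andP; split; [rewrite !mulr_ge0// ltW|nra].
  by move/eqP; rewrite !mulf_eq0 pnatr_eq0/= gt_eqF//= => /eqP.
have : cos (2 * pi * (1 - w)) = cos 0.
  transitivity (cos (2 * pi * w)); last by rewrite cw cos0.
  by rewrite -[RHS]cosN -[RHS]cosD2pi mulr2n; congr cos; ring.
move=> /cos_inj; rewrite !in_itv/= lexx => h.
have : 2 * pi * (1 - w) = 0.
  apply: h; last by rewrite ltW.
  by apply/andP; split; [rewrite !mulr_ge0 ?ltW// subr_gt0|nra].
by move/eqP; rewrite !mulf_eq0 pnatr_eq0/= gt_eqF//= subr_eq0 => /eqP; lra.
Qed.

End Angles.

Section Paths.
Variable R : realType.
Implicit Types (f : R -> R).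

Lemma IVT01 f c : (forall t, 0 <= t <= 1 -> ctn f t) ->
  Num.min (f 0) (f 1) <= c <= Num.max (f 0) (f 1) ->
  exists2 t, 0 <= t <= 1 & f t = c.
Proof.
move=> cf fc; have [|t] := @IVT R f 0 1 c ler01 _ fc.
  apply: continuous_in_subspaceT => t; rewrite inE /= in_itv/=; exact: cf.
by rewrite in_itv/=; exists t.
Qed.

(** A continuous function which only takes values in the discrete set where
    the cosine is 1 cannot move. *)
Lemma cos_eq1_constant f : (forall t, 0 <= t <= 1 -> ctn f t) ->
  (forall t, 0 <= t <= 1 -> cos (f t) = 1) -> f 0 = f 1.
Proof.
have p0 : 0 < pi :> R := pi_gt0 R.
wlog : f / f 0 <= f 1 => [hw cf c1|].
  have [|/ltW f10] := leP (f 0) (f 1); first by move=> f01; exact: hw.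
  apply/oppr_inj/(hw (fun t => - f t)); first by rewrite lerN2.
    by move=> t /cf h; exact: ctnN.
  by move=> t /c1; rewrite cosN.
move=> f01 cf c1; apply/eqP; rewrite eq_le f01 /=; apply/negP => /negP.
rewrite -ltNge => {}f01.
pose e := Num.min (f 1 - f 0) (pi / 2).
have e0 : 0 < e by rewrite lt_min subr_gt0 f01 divr_gt0.
have e1 : e <= f 1 - f 0 by rewrite ge_min lexx.
have e2 : e <= pi / 2 by rewrite ge_min lexx orbT.
have [t t01 ft] : exists2 t, 0 <= t <= 1 & f t = f 0 + e.
  apply: IVT01 => //; rewrite ge_min le_max lerDl (ltW e0) /=.
  by apply/orP; right; rewrite -lerBrDl.
have s0 : sin (f 0) = 0.
  by apply/cos1sin0; rewrite c1 ?lexx ?ler01// normr1.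
have := c1 _ t01; rewrite ft cosD s0 c1 ?lexx ?ler01// mul0r subr0 mul1r -cos0.
move=> /cos_inj; rewrite !in_itv/= lexx => h.
suff: e = 0 by move=> e00; rewrite e00 ltxx in e0.
by apply: h; apply/andP; split; lra.
Qed.

(** Along a path of vectors pointing into the closed upper half-plane the angle
    cannot leave [0, pi], since it would have to cross values of negative
    sine. *)
Lemma upper_half_turn (v : R -> R * R) f :
  (forall t, 0 <= t <= 1 -> ctn f t) ->
  (forall t, 0 <= t <= 1 -> arg_of (v t) (f t)) ->
  (forall t, 0 <= t <= 1 -> 0 <= (v t).2) ->
  0 <= f 0 <= pi -> 0 <= f 1 <= pi.
Proof.
have p0 : 0 < pi :> R := pi_gt0 R.
move=> cf av v2 /andP[f0 f1].
have s0 t : 0 <= t <= 1 -> 0 <= sin (f t).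
  move=> t01; have := v2 _ t01; have [r r0 ->] /= := av _ t01.
  by rewrite pmulr_rge0.
apply/andP; split; rewrite leNgt; apply/negP => h.
- pose e := Num.max (f 1) (- (pi / 2)).
  have e1 : f 1 <= e by rewrite le_max lexx.
  have e2 : - (pi / 2) <= e by rewrite le_max lexx orbT.
  have e3 : e < 0 by rewrite gt_max h /=; lra.
  have [t t01 ft] : exists2 t, 0 <= t <= 1 & f t = e.
    by apply: IVT01 => //; clearbody e;
      rewrite ge_min le_max e1 orbT (le_trans (ltW e3) f0).
  have := s0 _ t01; rewrite ft leNgt -[e]opprK sinN oppr_lt0 sin_gt0_pi//.
  by apply/andP; split; lra.
- pose e := Num.min (f 1) (pi + pi / 2).
  have e1 : e <= f 1 by rewrite ge_min lexx.
  have e2 : e <= pi + pi / 2 by rewrite ge_min lexx orbT.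
  have e3 : pi < e by rewrite lt_min h /=; lra.
  have [t t01 ft] : exists2 t, 0 <= t <= 1 & f t = e.
    by apply: IVT01 => //; clearbody e;
      rewrite ge_min le_max e1 (le_trans f1 (ltW e3)) orbT.
  have := s0 _ t01; rewrite ft leNgt -(subrK pi e) sinDpi oppr_lt0 sin_gt0_pi//.
  by apply/andP; split; lra.
Qed.

End Paths.

(** * Lifting the angle of a vector field *)

Section Lifting.
Variable R : realType.
Implicit Types (V : R * R -> R * R) (p q : R * R).

(** Uniform continuity in the form used for lifting angles: on a compact set
    where [V] has no zero, nearby vectors make an angle below a quarter turn. *)
Lemma compact_dot_gt0 (K : set (R * R)) V :
  compact K -> (forall x, ctn V x) -> (forall x, K x -> V x != 0) ->
  exists2 n, (0 < n)%N & forall p q, K p -> K q ->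
    `|p.1 - q.1| <= n%:R^-1 -> `|p.2 - q.2| <= n%:R^-1 -> 0 < dot (V p) (V q).
Proof.
move=> cK cV V0.
pose C := (K `*` K) `&` [set z | dot (V z.1) (V z.2) <= 0].
have cC : compact C.
  apply: compact_closedI; first exact: compact_setX.
  apply: (@closed_le_ctn R _ (fun z => dot (V z.1) (V z.2)) (fun=> 0)) => z;
    last exact: ctn_cst.
  by rewrite /dot; ctn_tac.
pose f (z : R * R * (R * R)) := Num.max `|z.1.1 - z.2.1| `|z.1.2 - z.2.2|.
have [|z [[/= K1 K2] d0]|m m0 hm] := compact_positive_bound cC (f := f).
- by move=> z; rewrite /f; ctn_tac.
- rewrite lt_max !normr_gt0 -negb_and !subr_eq0; apply/negP => /andP[/eqP e1 /eqP e2].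
  have e : z.1 = z.2 by case: z {K1 K2 d0} e1 e2 => -[? ?] [? ?] /= -> ->.
  by move: d0; rewrite /= e leNgt dot_refl_gt0 ?V0.
pose n := (Num.bound m^-1).
have n0 : m^-1 < n%:R by apply: archi_boundP; rewrite invr_ge0 ltW.
have nm : n.+1%:R^-1 < m.
  by rewrite invf_plt ?posrE// (lt_trans n0)// ltr_nat.
exists n.+1 => // p q Kp Kq h1 h2; rewrite ltNge; apply/negP => d0.
have := hm (p, q) (conj (conj Kp Kq) d0); rewrite leNgt /f gt_max /=.
by rewrite (le_lt_trans h1)// (le_lt_trans h2).
Qed.

(** The angle is lifted along each ray from the corner (0, 0) by adding up the
    small turns between consecutive points; a mesh that works for all rays
    makes the result continuous. *)
Lemma square_lift V a0 : (forall x, ctn V x) ->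
  (forall x, 0 <= x.1 <= 1 -> 0 <= x.2 <= 1 -> V x != 0) ->
  arg_of (V (0, 0)) a0 ->
  exists2 Th : R * R -> R, Th (0, 0) = a0 &
    forall x, 0 <= x.1 <= 1 -> 0 <= x.2 <= 1 -> ctn Th x /\ arg_of (V x) (Th x).
Proof.
move=> cV V0 Va0.
have [|n n0 dn] := compact_dot_gt0 (@compact_strip_box R 0 1) cV.
  by move=> x [x1 x2]; exact: V0.
pose s (k : nat) (x : R * R) : R * R := (k%:R / n%:R * x.1, k%:R / n%:R * x.2).
have n0' : 0 < n%:R :> R by rewrite ltr0n.
have sE k (y : R) : (k <= n)%N -> 0 <= y <= 1 -> 0 <= k%:R / n%:R * y <= 1.
  move=> kn /andP[y0 y1]; rewrite mulr_ge0 ?divr_ge0 ?ler0n//=.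
  by rewrite mulr_ile1 ?divr_ge0 ?ler0n// ler_pdivrMr// mul1r ler_nat.
have sd k (y : R) : 0 <= y <= 1 ->
    `|k%:R / n%:R * y - k.+1%:R / n%:R * y| <= n%:R^-1.
  move=> /andP[y0 y1].
  rewrite (_ : _ - _ = - (n%:R^-1 * y)); last by rewrite -natr1; ring.
  by rewrite normrN ger0_norm ?mulr_ge0 ?invr_ge0 ?ler0n// ler_piMr// invr_ge0 ler0n.
have ds k x : (k < n)%N -> 0 <= x.1 <= 1 -> 0 <= x.2 <= 1 ->
    0 < dot (V (s k x)) (V (s k.+1 x)).
  move=> kn x1 x2; apply: dn => /=; try exact: sd.
  - by split; apply: sE => //; exact: ltnW.
  - by split; exact: sE.
exists (fun x => a0 + \sum_(k < n) turn (V (s k x)) (V (s k.+1 x))).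
  rewrite big1 ?addr0// => k _; have s0 j : s j (0, 0) = (0, 0).
    by rewrite /s /= !mulr0.
  by rewrite !s0 turn_refl.
move=> x x1 x2; split.
  apply: ctnD; first exact: ctn_cst.
  apply: (@ctn_sum _ _ n (fun k x => turn (V (s k x)) (V (s k.+1 x)))) => k kn.
  apply: ctn_turn; last exact: ds.
    by apply: (@ctn_comp _ _ _ _ V) => //; rewrite /s; ctn_tac.
  by apply: (@ctn_comp _ _ _ _ V) => //; rewrite /s; ctn_tac.
have := @arg_of_sum R n (fun k => V (s k x)) a0.
have -> : s 0%N x = (0, 0) by rewrite /s !mul0r.
have -> : s n x = x by rewrite /s divff ?gt_eqF// !mul1r; case: x {x1 x2}.
by apply=> // k kn; exact: ds.
Qed.

End Lifting.

(** * The angle of a field along arcs from bottom to top *)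

Section Index.
Variables (R : realType) (V : R * R -> R * R) (kappa : R -> R) (x0 y0 : R).
Hypothesis V_ctn : forall p, ctn V p.
Hypothesis V_per : forall x y, V (x + 1, y) = V (x, y).
Hypothesis V_bot : forall x, (V (x, 0)).1 < 0 /\ (V (x, 0)).2 = 0.
Hypothesis V_top : forall x, 0 < (V (x, 1)).1 /\ (V (x, 1)).2 = 0.
Hypothesis V_neq0 : forall p, 0 <= p.2 <= 1 ->
  0 < kappa p.1 \/ p.2 <> y0 -> V p != 0.
Hypothesis kappa_ctn : forall x, ctn kappa x.
Hypothesis kappa_per : forall x, kappa (x + 1) = kappa x.
Hypothesis kappa_qc : forall x x' t, x0 <= x <= x0 + 1 -> x0 <= x' <= x0 + 1 ->
  0 <= t <= 1 -> Num.min (kappa x) (kappa x') <= kappa (x + t * (x' - x)).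

Hypothesis y0_in : 0 < y0 < 1.
Variable delta : R.
Hypothesis delta_gt0 : 0 < delta.

(* The strip without the open boxes around the zeros. *)
Let K := [set p : R * R | 0 <= p.2 <= 1 /\
  (delta <= kappa p.1 \/ delta <= `|p.2 - y0|)].

Let V_neq0K p : K p -> V p != 0.
Proof.
move=> [p2 [k|k]]; apply: V_neq0 => //; [left|right].
  exact: lt_le_trans k.
by move=> e; move: k; rewrite e subrr normr0 leNgt delta_gt0.
Qed.

(** By periodicity a mesh that is fine enough over one period is fine enough for
    all vertical segments. *)
Lemma vertical_mesh : exists2 n, (0 < n)%N & forall x y y', K (x, y) -> K (x, y') ->
  `|y - y'| <= n%:R^-1 -> 0 < dot (V (x, y)) (V (x, y')).
Proof.
pose K' := strip_box x0 (x0 + 1) `&`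
  [set p : R * R | delta <= Num.max (kappa p.1) `|p.2 - y0|].
have cK' : compact K'.
  apply: compact_closedI; first exact: compact_strip_box.
  apply: (@closed_le_ctn R _ (fun=> delta)
    (fun p : R * R => Num.max (kappa p.1) `|p.2 - y0|)) => p; ctn_tac.
have [|n n0 hn] := compact_dot_gt0 cK' V_ctn.
  move=> p [[p1 p2] /=]; rewrite le_max => h; apply: V_neq0K; split=> //.
  by apply/orP.
exists n => // x y y' [/= y1 ky] [/= y1' ky'] yy'.
have [m xm] := to_fundamental x0 x.
rewrite -(int_periodic (f := fun x => V (x, y)) _ m)//.
rewrite -(int_periodic (f := fun x => V (x, y')) _ m)//.
apply: hn => //=; last by rewrite subrr normr0 invr_ge0 ler0n.
  by split; [split|rewrite /= le_max int_periodic//; apply/orP].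
by split; [split|rewrite /= le_max int_periodic//; apply/orP].
Qed.

Let Ob p := delta < kappa p.1 \/ p.2 < y0 - delta.
Let Ot p := delta < kappa p.1 \/ y0 + delta < p.2.

(** Two angle functions, one lifted upwards from the bottom line and one
    downwards from the top line; they are good except above, respectively
    below, the box around the zeros. *)
Lemma two_angle_functions : exists thb tht : R * R -> R,
  [/\ forall x, thb (x, 0) = pi /\ tht (x, 1) = 0,
      forall x y, thb (x + 1, y) = thb (x, y) /\ tht (x + 1, y) = tht (x, y),
      forall p, 0 <= p.2 <= 1 -> Ob p -> ctn thb p /\ arg_of (V p) (thb p) &
      forall p, 0 <= p.2 <= 1 -> Ot p -> ctn tht p /\ arg_of (V p) (tht p)].
Proof.
have [n n0 hn] := vertical_mesh.
have n0' : 0 < n%:R :> R by rewrite ltr0n.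
have sE k (y : R) : (k <= n)%N -> 0 <= y <= 1 -> 0 <= k%:R / n%:R * y <= y.
  move=> kn /andP[y1 y2]; rewrite mulr_ge0 ?divr_ge0 ?ler0n//=.
  by rewrite ler_piMl// ler_pdivrMr// mul1r ler_nat.
have sd k (y : R) : 0 <= y <= 1 ->
    `|k%:R / n%:R * y - k.+1%:R / n%:R * y| <= n%:R^-1.
  move=> /andP[y1 y2].
  rewrite (_ : _ - _ = - (n%:R^-1 * y)); last by rewrite -natr1; ring.
  by rewrite normrN ger0_norm ?mulr_ge0 ?invr_ge0 ?ler0n// ler_piMr// invr_ge0 ler0n.
pose sb (k : nat) (p : R * R) : R * R := (p.1, k%:R / n%:R * p.2).
pose st (k : nat) (p : R * R) : R * R := (p.1, 1 - k%:R / n%:R * (1 - p.2)).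
have Kb k p : (k <= n)%N -> 0 <= p.2 <= 1 -> Ob p -> K (sb k p).
  move=> kn p2 op; have /andP[s1 s2] := sE _ _ kn p2.
  case/andP: (p2) => p20 p21; split; first by rewrite /= s1 (le_trans s2).
  case: op => [h|h]; [by left; exact: ltW|right].
  have h' : k%:R / n%:R * p.2 < y0 - delta by exact: le_lt_trans h.
  rewrite /= ler0_norm; first lra.
  by rewrite subr_le0 ltW// (lt_trans h')// gtrBl.
have Kt k p : (k <= n)%N -> 0 <= p.2 <= 1 -> Ot p -> K (st k p).
  move=> kn /andP[p20 p21] op.
  have p2 : 0 <= 1 - p.2 <= 1 by apply/andP; split; lra.
  have /andP[s1 s2] := sE _ _ kn p2.
  split; first by apply/andP; rewrite /=; split; lra.
  case: op => [h|h]; [by left; exact: ltW|right].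
  have h' : y0 + delta < 1 - k%:R / n%:R * (1 - p.2) by lra.
  rewrite /= ger0_norm; first lra.
  by rewrite subr_ge0 ltW// (lt_trans _ h')// ltrDl.
exists (fun p => pi + \sum_(k < n) turn (V (sb k p)) (V (sb k.+1 p))),
  (fun p => 0 + \sum_(k < n) turn (V (st k p)) (V (st k.+1 p))); split.
- move=> x; split; rewrite big1 ?addr0// => k _.
    by rewrite /sb /= !mulr0 turn_refl.
  by rewrite /st /= subrr !mulr0 turn_refl.
- by move=> x y; split; congr (_ + _); apply: eq_bigr => k _;
    rewrite /sb /st /= !V_per.
- move=> p p2 op; split.
    apply: ctnD; first exact: ctn_cst.
    apply: (@ctn_sum _ _ n (fun k x => turn (V (sb k x)) (V (sb k.+1 x)))) => k kn.
    apply: ctn_turn; [rewrite /sb; ctn_tac..|].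
    by apply: hn; [exact: (Kb k p (ltnW kn))|exact: (Kb k.+1 p)|exact: sd].
  have := @arg_of_sum R n (fun k => V (sb k p)) pi.
  have -> : sb n p = p by rewrite /sb divff ?gt_eqF// mul1r; case: (p).
  have -> : sb 0%N p = (p.1, 0) by rewrite /sb !mul0r.
  apply=> [k kn|].
    by apply: hn; [exact: (Kb k p (ltnW kn))|exact: (Kb k.+1 p)|exact: sd].
  have [v1 v2] := V_bot p.1; exists (- (V (p.1, 0)).1); first by rewrite oppr_gt0.
  by apply: injective_projections; rewrite /= ?cospi ?sinpi ?v2; ring.
- move=> p p2 op.
  have p2' : 0 <= 1 - p.2 <= 1 by case/andP: p2 => ? ?; apply/andP; split; lra.
  have ds k : (k < n)%N -> 0 < dot (V (st k p)) (V (st k.+1 p)).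
    move=> kn; apply: hn; [exact: (Kt k p (ltnW kn))|exact: (Kt k.+1 p)|].
    rewrite (_ : _ - _ = - (k%:R / n%:R * (1 - p.2) - k.+1%:R / n%:R * (1 - p.2))).
      by rewrite normrN sd.
    ring.
  split.
    apply: ctnD; first exact: ctn_cst.
    apply: (@ctn_sum _ _ n (fun k x => turn (V (st k x)) (V (st k.+1 x)))) => k kn.
    by apply: ctn_turn; [rewrite /st; ctn_tac..|exact: ds].
  have := @arg_of_sum R n (fun k => V (st k p)) 0.
  have -> : st n p = p.
    by rewrite /st divff ?gt_eqF// mul1r opprB addrC subrK; case: (p).
  have -> : st 0%N p = (p.1, 1) by rewrite /st !mul0r subr0.
  apply=> // ; have [v1 v2] := V_top p.1; exists (V (p.1, 1)).1 => //.
  by apply: injective_projections; rewrite /= ?cos0 ?sin0 ?v2; ring.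
Qed.

(** The two angle functions differ by the same constant over every fundamental
    domain, hence glue to an angle function on the complement of the boxes: the
    zeros of the field carry no total index. *)
Lemma final_angle : exists C, forall (g : R -> R * R) (th : R -> R),
  (forall t, ctn g t) -> (forall t, 0 <= (g t).2 <= 1) ->
  (forall t, 0 <= t <= 1 -> delta < Num.max (kappa (g t).1) `|(g t).2 - y0|) ->
  (g 0).2 = 0 -> (g 1).2 = 1 ->
  (forall t, 0 <= t <= 1 -> ctn th t /\ arg_of (V (g t)) (th t)) ->
  th 0 = pi -> th 1 = C.
Proof.
have [thb [tht [th01 thper hb ht]]] := two_angle_functions.
pose E (p : R * R) := delta < kappa p.1 /\ 0 <= p.2 <= 1.
have dper (m : int) p : thb (p.1 + m%:~R, p.2) - tht (p.1 + m%:~R, p.2) =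
    thb p - tht p.
  rewrite (int_periodic (f := fun x => thb (x, p.2) - tht (x, p.2))).
    by case: p.
  by move=> x; rewrite !(proj1 (thper _ _)) !(proj2 (thper _ _)).
have dE p q : E p -> E q -> thb p - tht p = thb q - tht q.
  move=> [kp p2] [kq q2]; have [m pm] := to_fundamental x0 p.1.
  have [l ql] := to_fundamental x0 q.1; rewrite -(dper m p) -(dper l q).
  set x := p.1 + m%:~R in pm *; set x' := q.1 + l%:~R in ql *.
  have kx : delta < kappa x by rewrite /x int_periodic.
  have kx' : delta < kappa x' by rewrite /x' int_periodic.
  pose z (t : R) : R * R := (x + t * (x' - x), p.2 + t * (q.2 - p.2)).
  have zE t : 0 <= t <= 1 -> E (z t).
    move=> /[dup] t01 /andP[t0 t1]; split=> /=.
      by apply: lt_le_trans (kappa_qc pm ql t01); rewrite lt_min kx kx'.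
    have -> : p.2 + t * (q.2 - p.2) = (1 - t) * p.2 + t * q.2 by ring.
    case/andP: p2 => p20 p21; case/andP: q2 => q20 q21; apply/andP; split.
      by rewrite addr_ge0 ?mulr_ge0// subr_ge0.
    apply: (@le_trans _ _ ((1 - t) * 1 + t * 1)); last by rewrite !mulr1 subrK.
    by rewrite lerD// ler_wpM2l// subr_ge0.
  have := @cos_eq1_constant R (fun t => thb (z t) - tht (z t)).
  have -> : z 0 = (x, p.2) by rewrite /z !mul0r !addr0.
  have -> : z 1 = (x', q.2) by rewrite /z !mul1r !(addrC _ (_ - _)) !subrK.
  apply=> t t01; have [k1 k2] := zE _ t01;
    have [|cb ab] := hb (z t) k2; try (by left);
    have [|ct at_] := ht (z t) k2; try (by left).
    by apply: ctnD; [|apply: ctnN];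
      [apply: (@ctn_comp _ _ _ z thb)|apply: (@ctn_comp _ _ _ z tht)] => //;
      rewrite /z; ctn_tac.
  exact: arg_of_cosB ab at_.
have [C C1 hC] : exists2 C, cos C = 1 & forall p, E p -> thb p = tht p + C.
  have [[p Ep]|nE] := pselect (exists p, E p).
    exists (thb p - tht p) => [|q Eq]; last by rewrite (dE p q)// addrC subrK.
    by case: Ep => k p2; apply: (@arg_of_cosB _ (V p));
      [apply: (hb _ p2 _).2; left|apply: (ht _ p2 _).2; left].
  by exists 0; [exact: cos0|move=> q Eq; case: nE; exists q].
exists C => g th cg g2 gd g0 g1 hth th0; have [y0_gt0 y0_lt1] := andP y0_in.
pose thK p := if asbool (Ob p) then thb p else tht p + C.
have gO t : 0 <= t <= 1 -> Ob (g t) \/ (Ot (g t) /\ ~ Ob (g t)).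
  move=> t01; have [|nO] := pselect (Ob (g t)); first by left.
  right; split=> //; have := gd _ t01; rewrite lt_max => /orP[h|].
    by case: nO; left.
  case: (ltP ((g t).2) y0) => h; last by rewrite ger0_norm ?subr_ge0// => h'; right; lra.
  by rewrite ltr0_norm ?subr_lt0// => h'; case: nO; right; lra.
have thKt t : Ot (g t) -> thK (g t) = tht (g t) + C.
  move=> ot; rewrite /thK; case: asboolP => // ob; apply: hC; split=> //.
  by case: ob ot => // h1 [//|h2]; have dd := delta_gt0; exfalso; lra.
have thKc t : 0 <= t <= 1 -> ctn (fun t => thK (g t)) t.
  move=> /gO[ob|[ot _]].
    apply: (@ctn_near _ _ (fun t => thb (g t))).
      have : \forall s \near t, Ob (g s).
        case: ob => h.
          have : \forall s \near t, delta < kappa (g s).1.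
            by apply: (@near_lt_ctn R _ (fun s => delta) (fun s => kappa (g s).1)) h; ctn_tac.
          by apply: filterS => s; left.
        have : \forall s \near t, (g s).2 < y0 - delta.
          by apply: (@near_lt_ctn R _ (fun s => (g s).2) (fun s => y0 - delta)) h; ctn_tac.
        by apply: filterS => s; right.
      by apply: filterS => s; rewrite /thK => /asboolP ->.
    by apply: (@ctn_comp _ _ _ g thb) => //; apply: (hb _ _ ob).1.
  apply: (@ctn_near _ _ (fun t => tht (g t) + C)).
    have : \forall s \near t, Ot (g s).
      case: ot => h.
        have : \forall s \near t, delta < kappa (g s).1.
          by apply: (@near_lt_ctn R _ (fun s => delta) (fun s => kappa (g s).1)) h; ctn_tac.
        by apply: filterS => s; left.
      have : \forall s \near t, y0 + delta < (g s).2.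
        by apply: (@near_lt_ctn R _ (fun s => y0 + delta) (fun s => (g s).2)) h; ctn_tac.
      by apply: filterS => s; right.
    by apply: filterS => s /thKt ->.
  apply: ctnD; last exact: ctn_cst.
  by apply: (@ctn_comp _ _ _ g tht) => //; apply: (ht _ _ ot).1.
have thKa t : 0 <= t <= 1 -> arg_of (V (g t)) (thK (g t)).
  move=> /gO[ob|[ot nob]].
    by rewrite /thK (asboolT ob); exact: (hb _ (g2 t) ob).2.
  rewrite /thK; case: asboolP => // _.
  by apply: arg_of_shift => //; exact: (ht _ (g2 t) ot).2.
have e : th 0 - thK (g 0) = th 1 - thK (g 1).
  apply: (@cos_eq1_constant R (fun t => th t - thK (g t))) => t t01.
    by apply: ctnD; [exact: (hth _ t01).1|apply: ctnN; exact: thKc].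
  exact: arg_of_cosB (hth _ t01).2 (thKa _ t01).
have b0 : Ob (g 0).
  have := gd 0; rewrite lexx ler01 g0 => /(_ isT); rewrite lt_max => /orP[h|]; [by left|].
  by rewrite sub0r normrN ger0_norm; [right; rewrite g0; lra|exact: ltW].
have t1 : Ot (g 1).
  have := gd 1; rewrite lexx ler01 g1 => /(_ isT); rewrite lt_max => /orP[h|]; [by left|].
  by rewrite ger0_norm ?subr_ge0 ?ltW// => h; right; rewrite g1; lra.
have e0 : thK (g 0) = pi.
  by rewrite /thK asboolT//; case: (g 0) g0 => a ? /= ->; exact: (th01 a).1.
have e1 : thK (g 1) = C.
  by rewrite thKt//; case: (g 1) g1 => a ? /= ->; rewrite (th01 a).2 add0r.
by move: e; rewrite th0 e0 e1 subrr => /esym/eqP; rewrite subr_eq0 => /eqP.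
Qed.

End Index.

Definition angle_arc (R : realType) (V : R * R -> R * R) (g : R -> R * R)
    (th : R -> R) :=
  [/\ forall t, ctn g t, forall t, 0 <= (g t).2 <= 1, (g 0).2 = 0, (g 1).2 = 1 &
      forall t, 0 <= t <= 1 -> ctn th t /\ arg_of (V (g t)) (th t)].

Section IndexUnique.
Variables (R : realType) (V : R * R -> R * R) (kappa : R -> R) (x0 y0 : R).
Hypothesis V_ctn : forall p, ctn V p.
Hypothesis V_per : forall x y, V (x + 1, y) = V (x, y).
Hypothesis V_bot : forall x, (V (x, 0)).1 < 0 /\ (V (x, 0)).2 = 0.
Hypothesis V_top : forall x, 0 < (V (x, 1)).1 /\ (V (x, 1)).2 = 0.
Hypothesis V_eq0 : forall p, 0 <= p.2 <= 1 ->
  V p = 0 <-> (kappa p.1 = 0 /\ p.2 = y0).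
Hypothesis kappa_ctn : forall x, ctn kappa x.
Hypothesis kappa_ge0 : forall x, 0 <= kappa x.
Hypothesis kappa_per : forall x, kappa (x + 1) = kappa x.
Hypothesis kappa_qc : forall x x' t, x0 <= x <= x0 + 1 -> x0 <= x' <= x0 + 1 ->
  0 <= t <= 1 -> Num.min (kappa x) (kappa x') <= kappa (x + t * (x' - x)).
Hypothesis y0_in : 0 < y0 < 1.

Lemma arc_gap g th : angle_arc V g th -> exists2 delta, 0 < delta &
  forall t, 0 <= t <= 1 -> delta <= Num.max (kappa (g t).1) `|(g t).2 - y0|.
Proof.
move=> [cg g2 _ _ hth].
have [||m m0 hm] := @compact_positive_bound R R `[0, 1]
  (fun t => Num.max (kappa (g t).1) `|(g t).2 - y0|) (@segment_compact R 0 1).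
- by move=> t; ctn_tac.
- move=> t /=; rewrite in_itv/= => /hth[_ /arg_of_neq0 /eqP vn].
  rewrite lt_max lt_neqAle eq_sym kappa_ge0 andbT normr_gt0 subr_eq0 -negb_and.
  by apply/negP => /andP[/eqP k0 /eqP e]; apply: vn; exact/V_eq0.
by exists m => // t t01; apply: hm; rewrite /= in_itv.
Qed.

Lemma arc_final_angle_unique g th g' th' : angle_arc V g th -> angle_arc V g' th' ->
  th 0 = pi -> th' 0 = pi -> th 1 = th' 1.
Proof.
move=> ga ga' e0 e0'; have [d d0 hd] := arc_gap ga; have [d' d0' hd'] := arc_gap ga'.
pose e := Num.min d d' / 2.
have m0 : 0 < Num.min d d' by rewrite lt_min d0.
have ee : e < Num.min d d' by rewrite /e; lra.
have ed : e < d by rewrite (lt_le_trans ee)// ge_min lexx.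
have ed' : e < d' by rewrite (lt_le_trans ee)// ge_min lexx orbT.
have [||C hC] := @final_angle R V kappa x0 y0 V_ctn V_per V_bot V_top _
  kappa_ctn kappa_per kappa_qc y0_in e _.
- move=> p p2 h; apply/eqP => /(V_eq0 p2)[k y]; case: h => //.
  by rewrite k ltxx.
- by rewrite /e; lra.
case: ga => cg g2 g0 g1 hth; case: ga' => cg' g2' g0' g1' hth'.
rewrite (hC g th)//; last by move=> t /hd; exact: lt_le_trans.
by rewrite (hC g' th')// => t /hd'; exact: lt_le_trans.
Qed.

End IndexUnique.

(** * Lifted twist homeomorphisms *)

Section TwistHomeo.
Variable R : realType.
Implicit Types (h k : R * R -> R * R) (p q : R * R) (W : set (R * R)).

(** The vertical retraction of the plane onto the strip. *)
Definition clampy p : R * R := (p.1, Num.min (Num.max p.2 0) 1).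

(** A lifted twist homeomorphism, extended to the whole plane so as to have the
    same displacement as on the nearest boundary line outside the strip. *)
Record twist_homeo h k : Prop := TwistHomeo {
  th_ctn : forall p, ctn h p;
  th_ctnV : forall p, ctn k p;
  th_K : cancel h k;
  th_VK : cancel k h;
  th_per : forall x y, h (x + 1, y) = ((h (x, y)).1 + 1, (h (x, y)).2);
  th_bot : forall p, p.2 <= 0 -> (h p).1 < p.1 /\ (h p).2 = p.2;
  th_top : forall p, 1 <= p.2 -> p.1 < (h p).1 /\ (h p).2 = p.2;
  th_mid : forall p, 0 < p.2 < 1 -> 0 < (h p).2 < 1;
  th_clamp : forall p, h (clampy p) - clampy p = h p - p }.

(** Periodic open sets stand for the open sets of the annulus. The closure makes
    the condition follow from an invariant density, which cannot see gaps of
    empty interior. *)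
Definition nondissipative h := forall W, open W ->
  (forall x y, W (x, y) -> W (x + 1, y) /\ W (x - 1, y)) ->
  (forall p, W p -> W (h p)) ->
  forall p, W p -> 0 < p.2 < 1 -> closure (h @` W) p.

Definition reflx p : R * R := (- p.1, p.2).

Lemma reflxK : involutive reflx.
Proof. by case=> x y; rewrite /reflx /= opprK. Qed.

Lemma ctn_reflx p : ctn reflx p.
Proof. by rewrite /reflx; ctn_tac. Qed.

Lemma clampy_reflx p : clampy (reflx p) = reflx (clampy p).
Proof. by []. Qed.

Lemma clampy_in p : 0 <= (clampy p).2 <= 1.
Proof. by rewrite /= le_min ler01 ge_min lexx le_max lexx !orbT. Qed.

Lemma clampy_id p : 0 <= p.2 <= 1 -> clampy p = p.
Proof.
by case: p => x y /= /andP[y0 y1]; rewrite /clampy /= max_l// min_l.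
Qed.

Lemma clampy_bot p : p.2 <= 0 -> clampy p = (p.1, 0).
Proof. by move=> p2; rewrite /clampy max_r// min_l. Qed.

Lemma clampy_top p : 1 <= p.2 -> clampy p = (p.1, 1).
Proof.
by move=> p2; rewrite /clampy max_l ?min_r// (le_trans ler01).
Qed.

Section Inverse.
Variables h k : R * R -> R * R.
Hypothesis H : twist_homeo h k.

Lemma th_y (p : R * R) :
  [\/ p.2 <= 0 /\ (h p).2 <= 0, 0 < p.2 < 1 /\ 0 < (h p).2 < 1 |
      1 <= p.2 /\ 1 <= (h p).2].
Proof.
have [p0|p0] := leP p.2 0; first by apply: Or31; rewrite (th_bot H p0).2.
have [p1|p1] := leP 1 p.2; first by apply: Or33; rewrite (th_top H p1).2.
have pm : 0 < p.2 < 1 by rewrite p0.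
by apply: Or32; split=> //; exact: (th_mid H).
Qed.

Lemma th_Vbot p : p.2 <= 0 -> p.1 < (k p).1 /\ (k p).2 = p.2.
Proof.
move=> p0; have := th_y (k p); rewrite (th_VK H); case.
- by case=> kp _; have := th_bot H kp; rewrite (th_VK H) => -[? <-].
- by case=> _ /andP[]; rewrite ltNge p0.
- by case=> _ /le_trans/(_ p0); rewrite leNgt ltr01.
Qed.

Lemma th_Vtop p : 1 <= p.2 -> (k p).1 < p.1 /\ (k p).2 = p.2.
Proof.
move=> p1; have := th_y (k p); rewrite (th_VK H); case.
- by case=> _ /(le_trans p1); rewrite leNgt ltr01.
- by case=> _ /andP[_]; rewrite ltNge p1.
- by case=> kp _; have := th_top H kp; rewrite (th_VK H) => -[? <-].
Qed.

Lemma th_Vmid p : 0 < p.2 < 1 -> 0 < (k p).2 < 1.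
Proof.
move=> /andP[p0 p1]; have := th_y (k p); rewrite (th_VK H); case.
- by case=> _; rewrite leNgt p0.
- by case.
- by case=> _; rewrite leNgt p1.
Qed.

Lemma th_Vper x y : k (x + 1, y) = ((k (x, y)).1 + 1, (k (x, y)).2).
Proof.
apply: (can_inj (th_K H)); rewrite (th_VK H) (th_per H) -surjective_pairing.
by rewrite (th_VK H).
Qed.

Lemma th_Vclamp p : k (clampy p) - clampy p = k p - p.
Proof.
set q := k p; have pE : h q = p by rewrite /q (th_VK H).
have e : clampy p - p = clampy q - q.
  rewrite -pE; case: (th_y q) => -[q2 _].
  - rewrite !clampy_bot//; last by rewrite (th_bot H q2).2.
    by apply: injective_projections; rewrite /= ?subrr// (th_bot H q2).2.
  - by rewrite !clampy_id ?subrr//; [|have := th_mid H q2]; move: q2;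
      move=> /andP[/ltW q0 /ltW q1]; rewrite ?q0 ?q1// => /andP[/ltW -> /ltW ->].
  - rewrite !clampy_top//; last by rewrite (th_top H q2).2.
    by apply: injective_projections; rewrite /= ?subrr// (th_top H q2).2.
have -> : k (clampy p) = clampy q.
  apply: (can_inj (th_K H)); rewrite (th_VK H).
  have := th_clamp H q; rewrite pE => /(canRL (subrK _)) ->.
  by apply/eqP; rewrite -subr_eq0 -[clampy p](subrK p) e; apply/eqP;
    rewrite -addrA addrC; apply: injective_projections => /=; ring.
apply/eqP; rewrite subr_eq addrAC -subr_eq; apply/eqP.
apply: injective_projections; move/(congr1 (fun u => (u.1, u.2))): e => [] /=; lra.
Qed.

(** Inverting exchanges left and right on the boundary lines, and the reflection
    in a vertical line exchanges them back. *)
Lemma twist_homeo_reflV :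
  twist_homeo (reflx \o k \o reflx) (reflx \o h \o reflx).
Proof.
split=> [p|p|p|p|x y|p p0|p p1|p pm|p] /=.
- apply: (@ctn_comp _ _ _ (k \o reflx) reflx); first exact: ctn_reflx.
  by apply: (@ctn_comp _ _ _ reflx k); [exact: (th_ctnV H)|exact: ctn_reflx].
- apply: (@ctn_comp _ _ _ (h \o reflx) reflx); first exact: ctn_reflx.
  by apply: (@ctn_comp _ _ _ reflx h); [exact: (th_ctn H)|exact: ctn_reflx].
- by rewrite reflxK (th_VK H) reflxK.
- by rewrite reflxK (th_K H) reflxK.
- have /= := th_Vper (- (x + 1)) y; rewrite opprD subrK /reflx /= => ->.
  by rewrite !opprD ?opprK ?addrNK ?subrK ?addrK.
- by have [] := @th_Vbot (reflx p) p0; split=> //; rewrite ltrNl.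
- by have [] := @th_Vtop (reflx p) p1; split=> //; rewrite ltrNr.
- exact: (@th_Vmid (reflx p) pm).
- rewrite -clampy_reflx; move/(congr1 reflx): (th_Vclamp (reflx p)) => [e1 e2].
  apply: injective_projections => /=.
    by move: e1; rewrite /= !opprB; lra.
  by move: e2 => /=; lra.
Qed.

Lemma nondissipative_reflV : nondissipative k ->
  nondissipative (reflx \o k \o reflx).
Proof.
move=> nk W oW Wper Wh p Wp p2.
have oW' : open (reflx @^-1` W).
  by apply: open_comp => // q _; exact: ctn_reflx.
have Wper' x y : W (reflx (x, y)) -> W (reflx (x + 1, y)) /\ W (reflx (x - 1, y)).
  by rewrite /reflx /= opprD opprB [1 + _]addrC => /Wper[].
have Wk q : W (reflx q) -> W (reflx (k q)) by move=> /Wh /=; rewrite reflxK.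
have Wp' : W (reflx (reflx p)) by rewrite reflxK.
move=> B nB; have nB' : nbhs (reflx p) (reflx @^-1` B).
  by apply: (ctn_reflx (p := reflx p)); rewrite reflxK.
have [_ [[q Wq <-] Bq]] := nk _ oW' Wper' Wk (reflx p) Wp' p2 _ nB'.
by exists (reflx (k q)); split=> //; exists (reflx q) => //=; rewrite reflxK.
Qed.

End Inverse.
End TwistHomeo.

(** * Pseudo-orbits from bottom to top *)

Section PseudoOrbits.
Variables (R : realType) (h k : R * R -> R * R) (sigma : R * R -> R) (c xc : R).
Hypothesis H : twist_homeo h k.
Hypothesis Hnd : nondissipative h.
Hypothesis c_gt0 : 0 < c.
Hypothesis c_lt1 : c < 1.
Hypothesis sigma_ctn : forall p, ctn sigma p.
Hypothesis sigma_per : forall x y, sigma (x + 1, y) = sigma (x, y).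
Hypothesis sigma_xc : forall y, sigma (xc, y) = c.
Hypothesis sigma_ge0 : forall p, 0 <= sigma p.
Hypothesis sigma_lec : forall p, sigma p <= c.
Hypothesis sigma_mono : forall x y y', y <= y' ->
  y + sigma (x, y) <= y' + sigma (x, y').

(** Above the point [o] a jump may lead to any height below [o.2 + sigma o]; the
    trivial jump is allowed even where [sigma] vanishes. *)
Definition jump (o p : R * R) :=
  p.1 = o.1 /\ (p.2 = o.2 \/ o.2 < p.2 < o.2 + sigma o).

Fixpoint reach n p : Prop :=
  if n is n'.+1 then exists2 q, reach n' q & jump (h q) p else p.2 < c.

Lemma reach_per n x y : reach n (x, y) -> reach n (x + 1, y) /\ reach n (x - 1, y).
Proof.
have sN u v : sigma (u - 1, v) = sigma (u, v) by rewrite -{2}(subrK 1 u) sigma_per.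
have hN u v : h (u - 1, v) = ((h (u, v)).1 - 1, (h (u, v)).2).
  by rewrite -{2 3}(subrK 1 u) (th_per H) /= addrK -surjective_pairing.
elim: n x y => [|n IH] x y //= [[u v] /IH[r1 r2] [/= xe jy]]; split.
- exists (u + 1, v) => //; rewrite (th_per H); split; rewrite /= ?xe//.
  by rewrite sigma_per -surjective_pairing.
- exists (u - 1, v) => //; rewrite hN; split; rewrite /= ?xe//.
  by rewrite sN -surjective_pairing.
Qed.

Lemma open_reach n : open (reach n).
Proof.
elim: n => [|n IH] /=.
  by apply: (@open_lt_ctn R _ (fun p : R * R => p.2) (fun=> c)) => p; ctn_tac.
rewrite openE => p [q rq [p1 p2]].
have near_q (f : R * R -> R * R) : ctn f p -> f p = h q ->
    \forall p' \near p, reach n (k (f p')).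
  move=> cf fp; have ck : ctn (fun p => k (f p)) p.
    by apply: (@ctn_comp _ _ _ f k) => //; exact: (th_ctnV H).
  have : nbhs (k (f p)) (reach n).
    by rewrite fp (th_K H); apply: open_nbhs_nbhs.
  exact: ck.
case: p2 => [p2|p2].
  have pq : p = h q by apply: injective_projections.
  have := near_q id (@ctn_id _ _) pq; apply: filterS => p' rp'.
  by exists (k p') => //; rewrite (th_VK H); split=> //; left.
pose s := p.2 - (h q).2; pose f (p : R * R) : R * R := (p.1, p.2 - s).
have cf : ctn f p by rewrite /f; ctn_tac.
have fp : f p = h q.
  by apply: injective_projections => //=; rewrite /s opprB addrC subrK.
have ns : \forall p' \near p, s < sigma (f p').
  apply: (@near_lt_ctn R _ (fun=> s) (fun p => sigma (f p))).
  - exact: ctn_cst.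
  - by apply: (@ctn_comp _ _ _ f sigma).
  - by rewrite fp /s; move: p2 => /andP[_]; lra.
have s0 : 0 < s by rewrite /s; move: p2 => /andP[]; lra.
have := near_q f cf fp; apply: filterS2 ns => p' sp' rp'.
exists (k (f p')) => //; rewrite (th_VK H); split=> //; right.
by apply/andP; rewrite /=; split; lra.
Qed.

(** Otherwise the open set of all reached points would lie below the top,
    be mapped into itself, and be pushed up strictly along the vertical line
    over [xc]; non-dissipativity forbids this at the highest point of that line
    in the closure of its image. *)
Lemma reach_top : exists n p, reach n p /\ 1 <= p.2.
Proof.
have cp := c_gt0; have c1 := c_lt1; apply: contrapT => nreach.
pose W : set (R * R) := \bigcup_n reach n.
have W1 p : W p -> p.2 < 1.
  by move=> [n _ rn]; rewrite ltNge; apply/negP => p1; apply: nreach; exists n, p.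
have oW : open W by apply: bigcup_open => n _; exact: open_reach.
have Wper x y : W (x, y) -> W (x + 1, y) /\ W (x - 1, y).
  by move=> [n _ /reach_per[r1 r2]]; split; exists n.
have Wjump p q : W p -> jump (h p) q -> W q.
  by move=> [n _ rn] j; exists n.+1 => //; exists p.
have Wh p : W p -> W (h p) by move=> Wp; apply: Wjump Wp _; split=> //; left.
have cl := Hnd oW Wper Wh.
pose E := [set y | closure (h @` W) (xc, y)].
have E1 : has_sup E.
  split.
    exists (c / 2); apply: cl; first by exists 0%N => //=; lra.
    by apply/andP; rewrite /=; split; lra.
  exists 1 => y Ey; rewrite leNgt; apply/negP => y1.
  have [_ [[q Wq <-] /= h1]] : h @` W `&` [set p | 1 < p.2] !=set0.
    apply: Ey; apply: open_nbhs_nbhs; split=> //.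
    by apply: (@open_lt_ctn R _ (fun=> 1) (fun p : R * R => p.2)) => p; ctn_tac.
  by have := W1 _ (Wh _ Wq); rewrite ltNge (ltW h1).
have c4 : 0 < c / 4 by lra.
have [y Ey ys] := sup_adherent c4 E1.
have Ec : E (c / 2).
  apply: cl; first by exists 0%N => //=; lra.
  by apply/andP; rewrite /=; split; lra.
have sc : c / 2 <= sup E by apply: ub_le_sup => //; case: E1.
have y0 : 0 < y by lra.
suff Ey' : E (y + c / 2).
  have : y + c / 2 <= sup E by apply: ub_le_sup => //; case: E1.
  by lra.
move=> B nB.
have [B' [oB' B'y] B'B] : exists2 B', open_nbhs (xc, y + c / 2) B' & B' `<=` B.
  by move: nB; rewrite nbhsE => -[B' ? ?]; exists B'.
pose f (p : R * R) : R * R := (p.1, p.2 + c / 2).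
have n1 : \forall p \near (xc, y), B' (f p).
  have cf : ctn f (xc, y) by rewrite /f; ctn_tac.
  by apply: cf; apply: open_nbhs_nbhs.
have n2 : \forall p \near (xc, y), c / 2 < sigma p.
  apply: (@near_lt_ctn R _ (fun=> c / 2) sigma) => //; first exact: ctn_cst.
  by rewrite sigma_xc; lra.
have n3 : \forall p \near (xc, y), 0 < p.2.
  by apply: (@near_lt_ctn R _ (fun=> 0) (fun p : R * R => p.2)) => //; ctn_tac.
have [_ [[q Wq <-] [[/= b1 b2] b3]]] := Ey _ (filterI (filterI n1 n2) n3).
have Wf : W (f (h q)).
  apply: Wjump Wq _; split=> //; right; apply/andP; rewrite /=; split; lra.
have fm : 0 < (f (h q)).2 < 1.
  by rewrite W1// andbT /=; lra.
have [z [hz Bz]] := cl _ Wf fm B' (open_nbhs_nbhs (conj oB' b1)).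
by exists z; split=> //; exact: B'B.
Qed.

Definition pseudo_orbit n (z : nat -> R * R) :=
  [/\ (z 0%N).2 <= c, forall i, (i < n)%N -> jump (h (z i)) (z i.+1) &
      1 <= (z n).2].

Lemma reach_orbit n p : reach n p ->
  exists z, [/\ (z 0%N).2 <= c, forall i, (i < n)%N -> jump (h (z i)) (z i.+1) &
    z n = p].
Proof.
elim: n p => [|n IH] p /=.
  by move=> pc; exists (fun=> p); split=> //; exact: ltW.
move=> [q /IH[z [z0 zj zn]] jq].
exists (fun i => if (i <= n)%N then z i else p); split=> //=; last by rewrite ltnn.
move=> i; rewrite ltnS => lin; rewrite lin; have [il|] := ltnP i n.
  exact: zj.
by move=> ni; rewrite (_ : i = n) ?zn//; lia.
Qed.

Lemma minimal_orbit : exists n z, pseudo_orbit n z /\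
  forall m z', (m < n)%N -> ~ pseudo_orbit m z'.
Proof.
have ex : exists n, `[< exists z, pseudo_orbit n z >].
  have [n [p [rp p1]]] := reach_top; have [z [z0 zj zn]] := reach_orbit rp.
  by exists n; apply/asboolP; exists z; split=> //; rewrite zn.
case: (ex_minnP ex) => n /asboolP[z oz] nmin; exists n, z; split=> // m z' mn oz'.
have : (n <= m)%N by apply: nmin; apply/asboolP; exists z'.
by rewrite leqNgt mn.
Qed.

(** In a shortest pseudo-orbit from the bottom to the top, shortcuts being
    impossible, the jumps on a common vertical line preserve the order. *)
Lemma good_orbit : exists n z,
  [/\ 0 < (z 0%N).2 <= c, 1 <= (z n).2,
      forall i, (i < n)%N -> [/\ 0 < (h (z i)).2 < 1,
        (z i.+1).1 = (h (z i)).1,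
        (h (z i)).2 <= (z i.+1).2 <= (h (z i)).2 + sigma (h (z i)) &
        c < (z i.+1).2] &
      forall i j, (i < n)%N -> (j < n)%N -> i != j ->
        (h (z i)).1 = (h (z j)).1 -> (h (z i)).2 <= (h (z j)).2 ->
        (z i.+1).2 < (z j.+1).2].
Proof.
have cp := c_gt0; have [n [z [[z0 zj zn] zmin]]] := minimal_orbit; exists n, z.
have n0 : (0 < n)%N.
  by case: n {zj zmin} zn => // /(le_trans)/(_ z0); rewrite leNgt c_lt1.
have F2 i : (i < n)%N -> (z i).2 < 1.
  move=> lin; rewrite ltNge; apply/negP => z1; apply: (zmin i z lin); split=> //.
  by move=> j ji; apply: zj; exact: ltn_trans lin.
have F3 i : (i < n)%N -> c < (z i.+1).2.
  move=> lin; rewrite ltNge; apply/negP => z1.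
  apply: (zmin (n - i.+1)%N (fun j => z (j + i.+1)%N)); first by lia.
  split=> //; last by rewrite subnK.
  by move=> j ji; rewrite addSn; apply: zj; lia.
have jle i : (i < n)%N -> (h (z i)).2 <= (z i.+1).2 <= (h (z i)).2 + sigma (h (z i)).
  move=> /zj[_ [->|/andP[a b]]]; first by rewrite lexx lerDl sigma_ge0.
  by rewrite !ltW.
have F0 i : (i < n)%N -> 0 < (z i).2.
  case: i => [|i] lin; last by apply: lt_trans (F3 i _) => //; exact: ltnW.
  rewrite ltNge; apply/negP => z00.
  have hz := (th_bot H z00).2; have := F3 _ lin; have /andP[_ j2] := jle _ lin.
  move=> h3; have := zj _ lin => -[_ [e|/andP[_ e]]]; first by rewrite hz in e; lra.
  by have := sigma_lec (h (z 0%N)); lra.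
have F5 i : (i < n)%N -> 0 < (h (z i)).2 < 1.
  by move=> lin; apply: (th_mid H); rewrite F0 ?F2.
split=> //; first by rewrite F0.
  by move=> i lin; split; [exact: F5|exact: (zj i lin).1|exact: jle|exact: F3].
have short i j : (i < j < n)%N -> jump (h (z i)) (z j.+1) -> False.
  move=> /andP[ij jn] jmp.
  pose z' m := if (m <= i)%N then z m else z (m + (j - i))%N.
  apply: (zmin (n - (j - i))%N z'); first by lia.
  split; rewrite /z' //.
  - move=> m mn; case: (ltngtP m i) => mi.
    + by apply: zj; lia.
    + by rewrite addSn; apply: zj; lia.
    + by rewrite mi (_ : i.+1 + (j - i) = j.+1)%N//; lia.
  - have -> : (n - (j - i) <= i)%N = false by apply/negbTE; lia.
    by have -> : (n - (j - i) + (j - i) = n)%N by lia.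
move=> i j lin ljn ij x y; rewrite ltNge; apply/negP => t.
have jij : jump (h (z i)) (z j.+1).
  have [x1 y1] := zj _ lin; have [x2 y2] := zj _ ljn; split; first by rewrite x2.
  have /andP[a1 _] := jle _ ljn.
  case: (ltgtP (h (z i)).2 (z j.+1).2) => e; [right|exfalso; lra|by left].
  case: y1 => [y1|/andP[y1 y1']]; first by exfalso; lra.
  by apply/andP; split=> //; lra.
have jji : jump (h (z j)) (z i.+1).
  have [x1 y1] := zj _ lin; have [x2 y2] := zj _ ljn; split; first by rewrite x1.
  have /andP[a1 _] := jle _ ljn.
  case: (ltgtP (h (z j)).2 (z i.+1).2) => e; [right|exfalso; lra|by left].
  case: y1 => [y1|/andP[y1 y1']]; first by exfalso; lra.
  apply/andP; split=> //; apply: (lt_le_trans y1').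
  have := sigma_mono (h (z i)).1 y; rewrite -surjective_pairing x.
  by rewrite -surjective_pairing.
case: (ltngtP i j) ij => // lij _; [apply: (short i j)|apply: (short j i)] => //.
  by rewrite lij.
by rewrite lij.
Qed.

End PseudoOrbits.

(** * A vertical push through prescribed points *)

Section Interpolation.
Variable R : realType.

Lemma eventually_le_mul (a b : R) : 0 < b ->
  exists L0, forall L, L0 <= L -> a <= L * b.
Proof. by move=> b0; exists (a / b) => L; rewrite ler_pdivrMr. Qed.

Lemma eventually_and (P Q : R -> Prop) :
  (exists L0, forall L, L0 <= L -> P L) -> (exists L0, forall L, L0 <= L -> Q L) ->
  exists L0, forall L, L0 <= L -> P L /\ Q L.
Proof.
move=> [a ha] [b hb]; exists (Num.max a b) => L; rewrite ge_max => /andP[la lb].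
by split; [exact: ha|exact: hb].
Qed.

Lemma eventually_forall_lt n (P : nat -> R -> Prop) :
  (forall i, (i < n)%N -> exists L0, forall L, L0 <= L -> P i L) ->
  exists L0, forall L, L0 <= L -> forall i, (i < n)%N -> P i L.
Proof.
elim: n => [|n IH] h; first by exists 0.
have [|L0 hL] := eventually_and (IH _) (h n (ltnSn n)).
  by move=> i lin; apply: h; exact: ltnW.
exists L0 => L /hL[a b] i; rewrite ltnS leq_eqVlt => /orP[/eqP ->//|]; exact: a.
Qed.

Lemma lt_max2 (a b a' b' : R) : a < a' -> b < b' -> Num.max a b < Num.max a' b'.
Proof. by move=> h1 h2; rewrite gt_max !lt_max h1 h2 orbT. Qed.

Lemma lt_min2 (a b a' b' : R) : a < a' -> b < b' -> Num.min a b < Num.min a' b'.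
Proof. by move=> h1 h2; rewrite lt_min !gt_min h1 h2 orbT. Qed.

Variables (n : nat) (w : nat -> R * R) (t : nat -> R).
Variables (sigma : R * R -> R) (c : R).
Hypothesis sigma_ctn : forall p, ctn sigma p.
Hypothesis sigma_ge0 : forall p, 0 <= sigma p.
Hypothesis sigma_bot : forall x, sigma (x, 0) = c.
Hypothesis sigma_top : forall x y, 1 <= y -> sigma (x, y) = c.
Hypothesis sigma_mono : forall x y y', y < y' ->
  y + sigma (x, y) < y' + sigma (x, y').
Hypothesis w_t : forall i, (i < n)%N -> [/\ 0 < (w i).2 < 1,
  (w i).2 <= t i <= (w i).2 + sigma (w i) & c < t i].
Hypothesis w_order : forall i j, (i < n)%N -> (j < n)%N -> i != j ->
  (w i).1 = (w j).1 -> (w i).2 <= (w j).2 -> t i < t j.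

(** The cone function of slope [L] at the [i]-th point: it takes the value [t i]
    there and, for large [L], stays below [t j] at the other points. *)
Let cone (L : R) i (p : R * R) := t i +
  Num.min (L^-1 * (p.2 - (w i).2)) (L * (p.2 - (w i).2)) - L * `|p.1 - (w i).1|.

(* The three lower barriers: the identity, a graph at height [c] over the bottom
   line, and a steep graph reaching the translation by [c] from height 1 on. *)
Let base (L : R) (p : R * R) := Num.max (Num.max p.2 (c + L^-1 * p.2))
  (Num.min (p.2 + c) (1 + c - L * (1 - p.2))).

Let slope_ok L := [/\ 1 <= L,
  forall i, (i < n)%N ->
    c + L^-1 * (w i).2 <= t i /\ 1 + c - L * (1 - (w i).2) <= t i &
  forall i, (i < n)%N -> forall j, (j < n)%N -> cone L j (w i) <= t i].

Lemma steep_slope : exists L, slope_ok L.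
Proof.
have h1 i : (i < n)%N -> exists L0, forall L, L0 <= L ->
    c + L^-1 * (w i).2 <= t i /\ 1 + c - L * (1 - (w i).2) <= t i.
  move=> /w_t[/andP[y0 y1] _ ct].
  have ct' : 0 < t i - c by rewrite subr_gt0.
  have y1' : 0 < 1 - (w i).2 by rewrite subr_gt0.
  have [L0 hL] := eventually_and (@eventually_le_mul 1 1 ltr01)
    (eventually_and (eventually_le_mul 1 ct') (eventually_le_mul 1 y1')).
  exists L0 => L /hL[L1 [L2 L3]]; rewrite mulr1 in L1.
  have Lp : 0 < L by apply: lt_le_trans L1.
  have L2' : L^-1 <= t i - c by rewrite -[L^-1]mul1r ler_pdivrMr// mulrC.
  have yL : L^-1 * (w i).2 <= L^-1 by rewrite ler_piMr ?invr_ge0// ltW.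
  by split; lra.
have h2 i : (i < n)%N -> forall j, (j < n)%N -> exists L0, forall L, L0 <= L ->
    cone L j (w i) <= t i.
  move=> lin j ljn; have [->|ij] := eqVneq i j.
    by exists 0 => L _; rewrite /cone !subrr normr0 !mulr0 minxx addr0 subr0.
  have [/andP[yi0 yi1] _ _] := w_t lin; have [/andP[yj0 yj1] _ _] := w_t ljn.
  rewrite /cone; set yi := (w i).2 in yi0 yi1 *; set yj := (w j).2 in yj0 yj1 *.
  have [e|ne] := eqVneq (w i).1 (w j).1; last first.
    have d0 : 0 < `|(w i).1 - (w j).1| by rewrite normr_gt0 subr_eq0.
    have [L0 hL] := eventually_and (@eventually_le_mul 1 1 ltr01)
      (eventually_le_mul (t j + 1 - t i) d0).
    exists L0 => L /hL[L1 L2]; rewrite mulr1 in L1.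
    have Lp : 0 < L by apply: lt_le_trans L1.
    suff : Num.min (L^-1 * (yi - yj)) (L * (yi - yj)) <= 1 by lra.
    rewrite ge_min; apply/orP; left.
    have : L^-1 * (yi - yj) <= L^-1 * 1 by rewrite ler_wpM2l ?invr_ge0 ?ltW//; lra.
    have : L^-1 <= 1 by rewrite invf_le1.
    lra.
  rewrite e subrr normr0; have [yij|yij] := leP yi yj.
    have tij := w_order lin ljn ij e yij.
    have yij' : yi < yj.
      rewrite lt_neqAle yij andbT; apply/eqP => eqy.
      have : t j < t i by apply: w_order => //; rewrite 1?eq_sym// -/yj -eqy.
      lra.
    have d0 : 0 < yj - yi by rewrite subr_gt0.
    have [L0 hL] := eventually_le_mul (t j - t i) d0.
    exists L0 => L /hL L1; suff : Num.min (L^-1 * (yi - yj)) (L * (yi - yj)) <=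
      L * (yi - yj) by lra.
    by rewrite ge_min lexx orbT.
  have tji : t j < t i by apply: w_order => //; [rewrite eq_sym|exact: ltW].
  have d0 : 0 < t i - t j by rewrite subr_gt0.
  have [L0 hL] := eventually_and (@eventually_le_mul 1 1 ltr01)
    (eventually_le_mul 1 d0).
  exists L0 => L /hL[L1 L2]; rewrite mulr1 in L1.
  have Lp : 0 < L by apply: lt_le_trans L1.
  have L2' : L^-1 <= t i - t j by rewrite -[L^-1]mul1r ler_pdivrMr// mulrC.
  suff : Num.min (L^-1 * (yi - yj)) (L * (yi - yj)) <= L^-1 by lra.
  rewrite ge_min; apply/orP; left.
  by rewrite ler_piMr ?invr_ge0 ?ltW//; lra.
have [L0 hL] := eventually_and (@eventually_le_mul 1 1 ltr01)
  (eventually_and (eventually_forall_lt h1)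
  (eventually_forall_lt (fun i lin => eventually_forall_lt (h2 i lin)))).
by exists L0; have [L1 [L2 L3]] := hL _ (lexx L0); split; rewrite ?mulr1 // in L1 *.
Qed.

(** A maximum of increasing functions is increasing, so the cones can be combined
    with the lower barriers and then capped by the increasing function
    [y + sigma (x, y)]. *)
Lemma vertical_push : exists P : R * R -> R,
  [/\ forall p, ctn P p, forall x y y', y < y' -> P (x, y) < P (x, y'),
      forall p, p.2 <= P p <= p.2 + sigma p,
      forall x, P (x, 0) = c /\ forall y, 1 <= y -> P (x, y) = y + c &
      forall i, (i < n)%N -> P (w i) = t i].
Proof.
have [L [L1 hb hc]] := steep_slope.
have Lp : 0 < L by apply: lt_le_trans L1.
have Lip : 0 < L^-1 by rewrite invr_gt0.
pose M := fix M m p := if m is m'.+1 then Num.max (M m' p) (cone L m' p) else base L p.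
have Mctn m p : ctn (M m) p.
  elim: m => [|m IH] /=; first by rewrite /base; ctn_tac.
  apply: (@ctn_max _ _ (M m) (cone L m)) => //; rewrite /cone; ctn_tac.
have Mmono m x y y' : y < y' -> M m (x, y) < M m (x, y').
  move=> yy; elim: m => [|m IH] /=.
    rewrite /base /=; apply: lt_max2; [apply: lt_max2 => //|apply: lt_min2].
    - by rewrite ltrD2l ltr_pM2l.
    - by rewrite ltrD2r.
    - by rewrite ltrD2l ltrN2 ltr_pM2l// ltrD2l ltrN2.
  apply: lt_max2 => //; rewrite /cone /= ltrD2r ltrD2l; apply: lt_min2.
    by rewrite ltr_pM2l// ltrD2r.
  by rewrite ltr_pM2l// ltrD2r.
have Mbase m p : base L p <= M m p.
  by elim: m => //= m IH; rewrite le_max IH.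
have Mcone m i p : (i < m)%N -> cone L i p <= M m p.
  elim: m => //= m IH; rewrite ltnS leq_eqVlt le_max => /orP[/eqP ->|/IH ->//].
  by rewrite lexx orbT.
have Mle m p b : base L p <= b -> (forall i, (i < m)%N -> cone L i p <= b) ->
    M m p <= b.
  move=> bb; elim: m => //= m IH hi; rewrite ge_max hi ?ltnS// andbT.
  by apply: IH => i lim; apply: hi; exact: ltnW.
exists (fun p => Num.min (p.2 + sigma p) (M n p)); split.
- by move=> p; apply: ctn_min => //; apply: ctnD => //; exact: ctn_snd.
- by move=> x y y' yy; apply: lt_min2; [exact: sigma_mono|exact: Mmono].
- move=> p; rewrite le_min ge_min lexx lerDl sigma_ge0 /= andbT.
  by apply: le_trans (Mbase n p); rewrite /base !le_max lexx.
- move=> x; split.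
    rewrite /= sigma_bot add0r min_l//; apply: le_trans (Mbase n _).
    by rewrite /base !le_max /= mulr0 addr0 lexx orbT.
  move=> y y1; rewrite /= sigma_top// min_l//; apply: le_trans (Mbase n _).
  rewrite /base le_max le_min /= lexx /=; apply/orP; right.
  have : 0 <= (L - 1) * (y - 1) by rewrite mulr_ge0// subr_ge0.
  lra.
- move=> i lin; have [/andP[y0 y1] /andP[t1 t2] ct] := w_t lin.
  have ci : cone L i (w i) = t i.
    by rewrite /cone !subrr normr0 !mulr0 minxx addr0 subr0.
  have -> : M n (w i) = t i.
    apply: le_anti; rewrite -{2}ci Mcone// andbT; apply: Mle.
      have [b1 b2] := hb _ lin.
      by rewrite /base !ge_max t1 b1 /= ge_min b2 orbT.
    by move=> j ljn; exact: hc.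
  by rewrite min_r.
Qed.

End Interpolation.

(** * Paths that never return to a past point *)

Section OrbitPath.
Variables (R : realType) (G : R * R -> R * R) (g0 : R -> R * R) (c : R) (N : nat).
Hypothesis G_ctn : forall p, ctn G p.
Hypothesis G_inj : injective G.
Hypothesis g0_ctn : forall s, ctn g0 s.
Hypothesis g0_1 : g0 1 = G (g0 0).
Hypothesis g0_2 : forall s, (g0 s).2 = c * s.
Hypothesis c_gt0 : 0 < c.
Hypothesis G_up : forall p, 0 <= p.2 -> c <= (G p).2.

(** The concatenation of the arcs [g0], [G \o g0], [G \o G \o g0], written as a
    sum in order to be visibly continuous. *)
Fixpoint iterated_path m (s : R) : R * R :=
  if m is m'.+1 then
    ((g0 (Num.min s 1)).1 + (G (iterated_path m' (Num.max (s - 1) 0))).1 - (g0 1).1,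
     (g0 (Num.min s 1)).2 + (G (iterated_path m' (Num.max (s - 1) 0))).2 - (g0 1).2)
  else g0 s.

Lemma ctn_iterated_path m s : ctn (iterated_path m) s.
Proof.
elim: m s => [|m IH] s /=; first exact: g0_ctn.
have c1 : ctn (fun s : R => g0 (Num.min s 1)) s by ctn_tac.
have c2 : ctn (fun s : R => G (iterated_path m (Num.max (s - 1) 0))) s.
  apply: (@ctn_comp _ _ _ (fun s : R => iterated_path m (Num.max (s - 1) 0)) G).
    exact: G_ctn.
  apply: (@ctn_comp _ _ _ (fun s : R => Num.max (s - 1) 0) (iterated_path m)).
    exact: IH.
  ctn_tac.
apply: ctn_pair.
- apply: ctnD; last exact: ctn_cst.
  by apply: ctnD; [exact: (ctn_fst c1)|exact: (ctn_fst c2)].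
- apply: ctnD; last exact: ctn_cst.
  by apply: ctnD; [exact: (ctn_snd c1)|exact: (ctn_snd c2)].
Qed.

Lemma iterated_path0 m s : s <= 1 -> iterated_path m s = g0 s.
Proof.
elim: m s => [|m IH] s s1 //=; rewrite min_l// max_r ?subr_le0// IH// -g0_1.
by rewrite !addrK -surjective_pairing.
Qed.

Lemma iterated_pathS m s : 0 <= s -> iterated_path m.+1 (s + 1) = G (iterated_path m s).
Proof.
move=> s0 /=; rewrite min_r ?lerDr// addrK max_l//.
by rewrite ![_ + _ - _]addrAC !subrr !add0r -surjective_pairing.
Qed.

Lemma iterated_path_stable m s : s <= m.+1%:R ->
  iterated_path m s = iterated_path m.+1 s.
Proof.
elim: m s => [|m IH] s sm; first by rewrite /iterated_path0 // (iterated_path0 1).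
have [s1|s1] := leP s 1; first by rewrite !iterated_path0.
rewrite -(subrK 1 s) !iterated_pathS ?subr_ge0 ?ltW// IH//.
by rewrite lerBlDr natr1.
Qed.

Let g := iterated_path N.

Let gS s : 0 <= s <= N%:R -> g (s + 1) = G (g s).
Proof.
rewrite /g => /andP[s0 sN]; case: N sN => [|M] sM; last first.
  by rewrite iterated_pathS// iterated_path_stable.
have -> : s = 0 by apply: le_anti; rewrite s0 andbT.
by rewrite add0r /= g0_1.
Qed.

Lemma real_nat_ind (Q : R -> Prop) : (forall s, 0 <= s <= 1 -> Q s) ->
  (forall s, 0 <= s <= N%:R -> Q s -> Q (s + 1)) ->
  forall s, 0 <= s <= N.+1%:R -> Q s.
Proof.
move=> Q0 QS; suff h m : (m <= N.+1)%N -> forall s, 0 <= s <= m%:R -> Q s.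
  exact: (h N.+1).
elim: m => [|m IH] mN s /andP[s0 sm].
  by apply: Q0; rewrite s0 (le_trans sm).
have [s1|s1] := leP s 1; first by apply: Q0; rewrite s0.
rewrite -(subrK 1 s); have sm' : 0 <= s - 1 <= m%:R.
  by rewrite subr_ge0 ltW//= lerBlDr natr1.
apply: QS; last by apply: IH => //; exact: ltnW.
by case/andP: sm' => -> /le_trans -> //; rewrite ler_nat.
Qed.

(** The height function separates the first arc from its images, and injectivity
    of [G] transports this to all later times. *)
Lemma orbit_path : exists g : R -> R * R,
  [/\ forall s, ctn g s, forall s, s <= 1 -> g s = g0 s,
      forall s, 0 <= s <= N%:R -> g (s + 1) = G (g s),
      forall s, 0 <= s <= N.+1%:R -> 0 <= (g s).2 &
      forall s s', 0 <= s -> s + 1 <= s' -> s' <= N.+1%:R -> g s' <> g s].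
Proof.
have g01 s : s <= 1 -> g s = g0 s by exact: iterated_path0.
have gpos s : 0 <= s <= N.+1%:R -> 0 <= (g s).2.
  move: s; apply: real_nat_ind => s /andP[s0 s1].
    by rewrite g01// g0_2 mulr_ge0// ltW.
  by move=> gs; rewrite gS ?s0// (le_trans (ltW c_gt0))// G_up.
exists g; split=> //; first by move=> s; exact: ctn_iterated_path.
have base s s' : 0 <= s < 1 -> s + 1 <= s' -> s' <= N.+1%:R -> g s' <> g s.
  move=> /andP[s0 s1] ss sN; rewrite (g01 s) ?ltW// => e.
  have s'N : 0 <= s' - 1 <= N%:R.
    by rewrite lerBlDr natr1 sN andbT subr_ge0; lra.
  have : c <= (g s').2.
    rewrite -(subrK 1 s') gS// G_up// gpos//.
    by case/andP: s'N => -> /le_trans -> //; rewrite ler_nat.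
  by rewrite e g0_2 leNgt gtr_pMr// s1.
have Q s : 0 <= s <= N.+1%:R ->
    forall s', s + 1 <= s' -> s' <= N.+1%:R -> g s' <> g s.
  have step u : 0 <= u <= N%:R ->
      (forall s', u + 1 <= s' -> s' <= N.+1%:R -> g s' <> g u) ->
      forall s', u + 1 + 1 <= s' -> s' <= N.+1%:R -> g s' <> g (u + 1).
    move=> /andP[u0 uN] IH s' us sN; rewrite -(subrK 1 s') !gS ?u0//.
      by move/G_inj; apply: IH; lra.
    by rewrite lerBlDr natr1 sN andbT; lra.
  move: s; apply: real_nat_ind => [s /andP[s0 s1] s' ss sN|]; last exact: step.
  have [s1'|s1'] := ltP s 1; first by apply: base; rewrite ?s0.
  have es : s = 0 + 1 by rewrite add0r; apply: le_anti; rewrite s1 s1'.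
  move: s' ss sN; rewrite es; apply: step; first by rewrite lexx ler0n.
  by move=> s'; apply: base; rewrite lexx ltr01.
by move=> s s' s0 ss sN; apply: Q => //; rewrite s0 (le_trans _ sN)// (le_trans _ ss)// lerDl.
Qed.

End OrbitPath.

Section ChordAngle.
Variables (R : realType) (g : R -> R * R) (L a0 : R).
Hypothesis g_ctn : forall s, ctn g s.
Hypothesis L_ge0 : 0 <= L.
Hypothesis g_neq : forall s s', 0 <= s -> s + 1 <= s' -> s' <= 1 + L -> g s' <> g s.
Hypothesis g_height : forall s, 0 <= s <= 1 + L ->
  (g 0).2 <= (g s).2 <= (g (1 + L)).2.

(** The chord from [g (L * t)] to [g (1 + L * t)] can be deformed, through
    nonzero chords, first to chords from the lowest point [g 0] and then to
    chords to the highest point [g (1 + L)]; all of these point upwards. *)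
Lemma chord_angle : arg_of (g 1 - g 0) a0 -> 0 <= a0 <= pi ->
  exists th : R -> R, [/\ 0 <= th 0 <= pi, 0 <= th 1 <= pi &
    forall t, 0 <= t <= 1 ->
      ctn th t /\ arg_of (g (1 + L * t) - g (L * t)) (th t)].
Proof.
move=> ga a0p.
(* The unit square parametrises the chords: the side [x.1 = 1] gives the chords in
   question, the side [x.1 = 0] those from the lowest point and the side
   [x.2 = 1] those to the highest point. *)
pose Psi (x : R * R) : R * R :=
  ((g (1 + L * x.2)).1 - (g (L * (x.1 * x.2))).1,
   (g (1 + L * x.2)).2 - (g (L * (x.1 * x.2))).2).
have PsiE x : Psi x = g (1 + L * x.2) - g (L * (x.1 * x.2)) by [].
have cPsi x : ctn Psi x.
  have c1 : ctn (fun x : R * R => g (1 + L * x.2)) x.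
    by apply: (@ctn_comp _ _ _ (fun x : R * R => 1 + L * x.2) g) => //; ctn_tac.
  have c2 : ctn (fun x : R * R => g (L * (x.1 * x.2))) x.
    by apply: (@ctn_comp _ _ _ (fun x : R * R => L * (x.1 * x.2)) g) => //; ctn_tac.
  by apply: ctn_pair; apply: ctnD; rewrite ?ctnN//;
    [exact: (ctn_fst c1)|apply: ctnN; exact: (ctn_fst c2)
    |exact: (ctn_snd c1)|apply: ctnN; exact: (ctn_snd c2)].
have L0 := L_ge0.
have Lt t : 0 <= t <= 1 -> 0 <= L * t <= L.
  by move=> /andP[t0 t1]; rewrite mulr_ge0//= ler_piMr.
have Psi0 x : 0 <= x.1 <= 1 -> 0 <= x.2 <= 1 -> Psi x != 0.
  move=> /andP[x0 x1] x2; rewrite PsiE subr_eq0; apply/eqP.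
  have /andP[l0 l1] := Lt _ x2; case/andP: (x2) => x20 x21.
  apply: g_neq; first by rewrite !mulr_ge0.
    by rewrite addrC lerD2l ler_wpM2l// ler_piMl.
  by rewrite lerD2l.
have Psi00 : arg_of (Psi (0, 0)) a0 by rewrite PsiE /= !mulr0 addr0.
have [Th Th0 hTh] := square_lift cPsi Psi0 Psi00.
have i0 : (0 : R) <= (0 : R) <= (1 : R) by apply/andP.
have i1 : (0 : R) <= (1 : R) <= (1 : R) by apply/andP.
have edge (f : R -> R * R) : (forall t, 0 <= t <= 1 -> 0 <= (f t).1 <= 1 /\ 0 <= (f t).2 <= 1) ->
    (forall t, ctn f t) -> (forall t, 0 <= t <= 1 -> 0 <= (Psi (f t)).2) ->
    0 <= Th (f 0) <= pi -> 0 <= Th (f 1) <= pi.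
  move=> f01 cf fpos; apply: (@upper_half_turn R (Psi \o f) (Th \o f)) => //.
    move=> t t01; have [f1 f2] := f01 _ t01.
    by apply: (@ctn_comp _ _ _ f Th) => //; apply: (hTh _ f1 f2).1.
  by move=> t t01; have [f1 f2] := f01 _ t01; apply: (hTh _ f1 f2).2.
have e01 : 0 <= Th (0, 1) <= pi.
  apply: (edge (fun t => (0, t))) => //=; first by move=> t; ctn_tac.
    move=> t t01; rewrite mul0r mulr0 subr_ge0.
    have /andP[l0 l1] := Lt _ t01.
    have hh : 0 <= 1 + L * t <= 1 + L by rewrite lerD2l l1 addr_ge0.
    by case/andP: (g_height hh).
  by rewrite Th0.
have e11 : 0 <= Th (1, 1) <= pi.
  apply: (edge (fun t => (t, 1))) => //=; first by move=> t; ctn_tac.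
  move=> t t01; rewrite !mulr1 subr_ge0.
  have /andP[l0 l1] := Lt _ t01.
  have hh : 0 <= L * t <= 1 + L by rewrite l0 (le_trans l1)// lerDr.
  by case/andP: (g_height hh).
have e10 : 0 <= Th (1, 0) <= pi.
  apply: (edge (fun t => (t, 0))) => //=; first by move=> t; ctn_tac.
    move=> t t01; rewrite !mulr0 addr0 subr_ge0.
    have hh : (0 : R) <= 1 <= 1 + L by apply/andP; split; [exact: ler01|rewrite lerDl].
    by case/andP: (g_height hh).
  by rewrite Th0.
exists (fun t => Th (1, t)); split=> // t t01.
have [ct at_] := hTh (1, t) i1 t01; split.
  by apply: (@ctn_comp _ _ _ (fun t : R => ((1 : R), t)) Th) => //; ctn_tac.
by move: at_; rewrite PsiE /= mul1r.
Qed.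

End ChordAngle.

(** * An arc turning by half a turn through the upper half-plane *)

Section ArcExistence.
Variables (R : realType) (h k : R * R -> R * R) (kappa : R -> R) (y0 xc : R).
Hypothesis H : twist_homeo h k.
Hypothesis Hnd : nondissipative h.
Hypothesis kappa_ctn : forall x, ctn kappa x.
Hypothesis kappa_ge0 : forall x, 0 <= kappa x.
Hypothesis kappa_per : forall x, kappa (x + 1) = kappa x.
Hypothesis kappa_xc : 1 <= kappa xc.
Hypothesis y0_in : 0 < y0 < 1.
Hypothesis fixed_pt : forall p, 0 <= p.2 <= 1 -> h p = p ->
  kappa p.1 = 0 /\ p.2 = y0.

Let V p := h p - p.

Let V_ctn p : ctn V p.
Proof.
have -> : V = fun q => ((h q).1 - q.1, (h q).2 - q.2).
  by apply/funext => q; rewrite /V; apply: injective_projections.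
have hc := @th_ctn _ _ _ H p; ctn_tac.
Qed.

Let dist (q : R * R) := Num.max (kappa q.1) `|q.2 - y0|.

Let dist_ctn q : ctn dist q.
Proof. by rewrite /dist; ctn_tac. Qed.

(** Away from the fixed points the displacement is bounded below, uniformly
    thanks to periodicity. *)
Lemma displacement_bound delta : 0 < delta -> delta <= y0 -> delta <= 1 - y0 ->
  exists2 m, 0 < m &
    forall p, delta <= dist (h p) -> m <= Num.max `|(V p).1| `|(V p).2|.
Proof.
move=> d0 dy0 dy1.
have cC : compact (strip_box 0 1 `&` [set p | delta <= dist (h p)]).
  apply: compact_closedI; first exact: compact_strip_box.
  apply: (@closed_le_ctn R _ (fun=> delta) (fun p => dist (h p))) => p.
    exact: ctn_cst.
  by apply: (@ctn_comp _ _ _ h dist) => //; exact: (th_ctn H).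
have [||m m0 hm] := @compact_positive_bound R _ _
  (fun p => Num.max `|(V p).1| `|(V p).2|) cC.
- by move=> p; have vc := @V_ctn p; ctn_tac.
- move=> p [[_ p2] /= dp]; rewrite lt_max !normr_gt0 -negb_and.
  apply/negP => /andP[/eqP v1 /eqP v2].
  have hp : h p = p.
    by apply/eqP; rewrite -subr_eq0; apply/eqP; exact: injective_projections.
  have [k1 e] := fixed_pt p2 hp; move: dp; rewrite hp /dist k1 e subrr normr0.
  by rewrite maxxx leNgt d0.
exists m => //.
have per (i : int) x y : h (x + i%:~R, y) = ((h (x, y)).1 + i%:~R, (h (x, y)).2).
  pose f x := ((h (x, y)).1 - x, (h (x, y)).2).
  have fE : f (x + i%:~R) = f x.
    apply: int_periodic => u; rewrite /f (th_per H) /=; congr (_, _); ring.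
  move: fE => [e1 e2]; apply: injective_projections => //=; lra.
have strip p : 0 <= p.2 <= 1 -> delta <= dist (h p) ->
    m <= Num.max `|(V p).1| `|(V p).2|.
  case: p => x y y01 dp; have [i xi] := to_fundamental 0 x.
  have VE : V (x + i%:~R, y) = V (x, y).
    by rewrite /V per; apply: injective_projections => //=; rewrite opprD addrACA subrr addr0.
  rewrite -VE; apply: hm; split; first by split=> //=; rewrite add0r in xi.
  by move: dp; rewrite /= per /dist /= int_periodic.
have VE p : V p = V (clampy p) by rewrite /V (th_clamp H).
move=> p dp; have [p0|p0] := leP p.2 0.
  rewrite VE; apply: strip; first exact: clampy_in.
  rewrite clampy_bot// /dist (th_bot H _).2//= le_max sub0r normrN ger0_norm ?dy0 ?orbT//.
  by case/andP: y0_in => /ltW.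
have [p1|p1] := leP 1 p.2.
  rewrite VE; apply: strip; first exact: clampy_in.
  rewrite clampy_top// /dist (th_top H _).2//= le_max ger0_norm ?dy1 ?orbT//.
  by rewrite subr_ge0; case/andP: y0_in => _ /ltW.
by apply: strip => //; rewrite (ltW p0) ltW.
Qed.

(** The size allowed for the vertical pushes: constant off a box around the
    fixed points, zero near them, and varying slowly enough for
    [y + sigma (x, y)] to be increasing. *)
Lemma push_size : exists (c : R) (sigma : R * R -> R),
  [/\ 0 < c < 1,
      forall p, ctn sigma p,
      (forall x y, sigma (x + 1, y) = sigma (x, y)) /\ (forall p, 0 <= sigma p <= c),
      [/\ forall y, sigma (xc, y) = c, forall x y, y <= 0 -> sigma (x, y) = c,
          forall x y, 1 <= y -> sigma (x, y) = c &
          forall x y y', y < y' -> y + sigma (x, y) < y' + sigma (x, y')] &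
      forall p, 0 < sigma (h p) -> c < Num.max `|(V p).1| `|(V p).2|].
Proof.
have [y00 y01] := andP y0_in; have kx := kappa_xc.
pose d := Num.min (Num.min y0 (1 - y0)) 1 / 2.
have dm0 : 0 < Num.min (Num.min y0 (1 - y0)) 1 by rewrite !lt_min y00 subr_gt0 y01 ltr01.
have d0 : 0 < d by rewrite /d divr_gt0.
have [dy0 dy1 d1] : [/\ 2 * d <= y0, 2 * d <= 1 - y0 & 2 * d <= 1].
  by rewrite /d mulrC divfK//; split; rewrite !ge_min lexx ?orbT.
have [||m m0 hm] := displacement_bound d0; [by lra..|].
pose c := Num.min d m / 2.
have dm : 0 < Num.min d m by rewrite lt_min d0.
have c0 : 0 < c by rewrite /c divr_gt0.
have [cd cm] : 2 * c <= d /\ 2 * c <= m.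
  by rewrite /c mulrC divfK//; split; rewrite ge_min lexx ?orbT.
pose a (p : R * R) := Num.max (kappa p.1 - d) (`|p.2 - y0| - d).
pose s p := Num.min c (Num.max 0 (a p / 2)).
have sc p : 2 * c <= a p -> s p = c.
  by move=> h1; rewrite /s min_l// le_max; apply/orP; right; lra.
exists c, s; split.
- by apply/andP; split; lra.
- by move=> p; rewrite /s /a; ctn_tac.
- split=> [x y|p]; first by rewrite /s /a /= kappa_per.
  by rewrite /s le_min ge_min lexx le_max lexx (ltW c0).
- split.
  + by move=> y; apply: sc; rewrite /a le_max /=; apply/orP; left; lra.
  + move=> x y yy; apply: sc; rewrite /a le_max /=; apply/orP; right.
    by rewrite ler0_norm; lra.
  + move=> x y yy; apply: sc; rewrite /a le_max /=; apply/orP; right.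
    by rewrite ger0_norm; lra.
  + move=> x y y' yy.
    have : a (x, y) <= a (x, y') + (y' - y).
      rewrite /a /= ge_max; apply/andP; split.
        have : kappa x - d <= Num.max (kappa x - d) (`|y' - y0| - d) by rewrite le_max lexx.
        by lra.
      have : `|y' - y0| - d <= Num.max (kappa x - d) (`|y' - y0| - d).
        by rewrite le_max lexx orbT.
      have : `|y - y0| <= `|y' - y0| + `|y - y'|.
        by rewrite -(subrKA y' y (- y0)) addrC; exact: ler_normD.
      by rewrite (ler0_norm (x := y - y')); lra.
    rewrite /s; set A := a (x, y); set A' := a (x, y') => hA.
    suff : Num.min c (Num.max 0 (A / 2)) <=
        Num.min c (Num.max 0 (A' / 2)) + (y' - y) / 2 by lra.
    have [h1|h1] := leP c (Num.max 0 (A' / 2)).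
      rewrite ge_min; apply/orP; left; lra.
    rewrite ge_min; apply/orP; right; rewrite ge_max.
    have : 0 <= Num.max 0 (A' / 2) by rewrite le_max lexx.
    have : A' / 2 <= Num.max 0 (A' / 2) by rewrite le_max lexx orbT.
    by move=> *; apply/andP; split; lra.
- move=> p; rewrite /s lt_min c0 /= lt_max ltxx /= => ap.
  apply: (@lt_le_trans _ _ m); first by lra.
  apply: hm; rewrite /dist; move: ap; rewrite pmulr_lgt0 ?invr_gt0//.
  rewrite /a lt_max !subr_gt0 => /orP[] h1; rewrite le_max (ltW h1) ?orbT//.
Qed.

(** Following the pushed homeomorphism along a pseudo-orbit produces a path that
    never comes back to a past point, and runs from the bottom to above the
    top. Between its lowest and its highest point the chord angle stays in
    [0, pi]. *)
Lemma turning_arc : exists g th, [/\ angle_arc V g th, th 0 = pi & th 1 = 0].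
Proof.
have [c [sigma [c01 csig [sper s0c] [sxc sbot stop smono] sV]]] := push_size.
have [c0 c1] := andP c01.
have sge0 p : 0 <= sigma p by case/andP: (s0c p).
have slec p : sigma p <= c by case/andP: (s0c p).
have smono' x y y' : y <= y' -> y + sigma (x, y) <= y' + sigma (x, y').
  by rewrite le_eqVlt => /predU1P[->//|/(smono x)/ltW].
have [n [z [z0 zn zi zord]]] := good_orbit H Hnd c0 c1 csig sper sxc sge0 slec smono'.
have [|P [Pctn Pmono Ps P01 Pi]] := @vertical_push R n (fun i => h (z i))
  (fun i => (z i.+1).2) sigma c csig sge0 (fun x => sbot x 0 (lexx 0)) stop smono _ zord.
  by move=> i /zi[].
pose G p : R * R := ((h p).1, P (h p)).
have Gctn p : ctn G p.
  apply: ctn_pair; first exact: (ctn_fst (th_ctn H (p := p))).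
  by apply: (@ctn_comp _ _ _ h P) => //; exact: (th_ctn H).
have Pinj x y y' : P (x, y) = P (x, y') -> y = y'.
  by case: (ltgtP y y') => // /(Pmono x) hlt e; rewrite e ltxx in hlt.
have Ginj : injective G.
  move=> p q [e1 e2]; apply: (can_inj (th_K H)).
  apply: injective_projections => //; apply: (Pinj (h p).1).
  by rewrite {2}e1 -!surjective_pairing.
have Gz i : (i < n)%N -> G (z i) = z i.+1.
  move=> lin; have [_ e _ _] := zi _ lin.
  by apply: injective_projections => //=; rewrite Pi.
have hpos p : 0 <= p.2 -> 0 <= (h p).2.
  move=> p0; case: (th_y H p) => -[p1 hp].
  - by rewrite (th_bot H p1).2.
  - by case/andP: hp => /ltW.
  - by rewrite (le_trans ler01).
have Gup p : 0 <= p.2 -> c <= (G p).2.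
  move=> /hpos; rewrite /= le_eqVlt => /predU1P[e|e].
    by rewrite [h p]surjective_pairing -e (P01 _).1.
  by rewrite -((P01 (h p).1).1) ltW// {2}[h p]surjective_pairing Pmono.
have Gtop p : 1 <= p.2 -> (G p).2 = p.2 + c.
  move=> p1; have [_ hp] := th_top H p1.
  by rewrite /= [h p]surjective_pairing (P01 _).2 hp.
set t0 := (z 0%N).2 in z0; set x1 := (z 0%N).1.
have [t00 t0c] := andP z0.
pose x := (k (x1, 0)).1.
have hx : h (x, 0) = (x1, 0).
  have [_ e] := th_Vbot H (p := (x1, 0)) (lexx 0).
  by rewrite -[0 in LHS]e /x -surjective_pairing (th_VK H).
(* The first arc starts on the bottom line, ends at the image of its start and
   passes through the start of the pseudo-orbit at time [t0 / c]. *)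
pose g0 (u : R) : R * R := (x + Num.min 1 (u * (c / t0)) * (x1 - x), c * u).
have ct0 : 1 <= c / t0 by rewrite ler_pdivlMr// mul1r.
have g0ctn s : ctn g0 s by rewrite /g0; ctn_tac.
have g00 : g0 0 = (x, 0) by rewrite /g0 mul0r min_r// mul0r addr0 mulr0.
have g01 : g0 1 = G (g0 0).
  rewrite g00 /G hx (P01 _).1 /g0 mul1r min_l// !mul1r mulr1 addrC subrK//.
pose u := t0 / c.
have u01 : 0 < u <= 1 by rewrite /u divr_gt0//= ler_pdivrMr// mul1r.
have [u0 u1] := andP u01.
have g0u : g0 u = z 0%N.
  rewrite /g0 /u mulrA divfK ?gt_eqF// divff ?gt_eqF// minxx mul1r addrC subrK.
  by rewrite mulrC divfK ?gt_eqF// -surjective_pairing.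
have [g [gctn ge gS gpos gneq]] :=
  @orbit_path R G g0 c n.+2 Gctn Ginj g0ctn g01 (fun=> erefl) c0 Gup.
have gz i : (i <= n)%N -> g (u + i%:R) = z i.
  elim: i => [|i IH] lin; first by rewrite addr0 ge.
  have il := ltnW lin; rewrite -natr1 addrA gS ?IH ?Gz//.
  have : i%:R + 1 <= n.+2%:R :> R by rewrite natr1 ler_nat; lia.
  by have := ler0n R i; move=> *; apply/andP; split; lra.
have n2 : n.+2%:R = n%:R + 2 :> R by rewrite -addn2 natrD.
have n3 : n.+3%:R = n%:R + 3 :> R by rewrite -addn3 natrD.
have nn := ler0n R n.
have gn1 : 1 + c <= (g (u + n%:R + 1)).2.
  by rewrite gS ?gz// ?Gtop ?lerD2r//; apply/andP; split; lra.
have gn2 : 1 + c + c <= (g (u + n%:R + 1 + 1)).2.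
  rewrite gS ?Gtop ?lerD2r//; last by apply/andP; split; lra.
  by rewrite (le_trans _ gn1)// lerDl ltW.
(* [T] is a time of greatest height. As the path climbs by [c] at each step above
   the top, waiting for two more steps ensures that the point at time [T - 1]
   lies above the top already. *)
have [T] := @EVT_max R (fun s => (g s).2) 0 n.+3%:R (ler0n _ _)
  (continuous_subspaceT (fun s => ctn_snd (gctn s))).
rewrite in_itv/= => /andP[T0 Tn] Tmax.
have gT : 1 + c + c <= (g T).2.
  apply: (le_trans gn2); apply: Tmax; rewrite in_itv/=; apply/andP; split; lra.
have T1 : 1 <= T.
  rewrite leNgt; apply/negP => T1; move: gT; rewrite (ge _ (ltW T1)) /g0 /=.
  have : c * T <= c by rewrite ger_pMr// ltW.
  lra.
pose L := T - 1; have L0 : 0 <= L by rewrite subr_ge0.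
have LT : 1 + L = T by rewrite addrC subrK.
have LN : L <= n.+2%:R by rewrite /L; lra.
have gL : 1 <= (g L).2.
  have e : g T = G (g L) by rewrite -gS ?L0// subrK.
  rewrite leNgt; apply/negP => gL1.
  have gL0 : 0 <= (g L).2 by rewrite gpos// L0/=; lra.
  have hg : (h (g L)).2 < 1.
    case: (th_y H (g L)) => -[q1 hq].
    - exact: le_lt_trans hq ltr01.
    - by case/andP: hq.
    - by move: gL1; rewrite ltNge q1.
  have /andP[_ hP] := Ps (h (g L)); have := slec (h (g L)).
  by move: gT; rewrite e /=; lra.
pose V0 := V (x, 0).
have [vx vy] := th_bot H (p := (x, 0)) (lexx 0).
have Vdot p : G p <> p -> 0 < dot (V p) (G p - p).
  move=> Gp; have e : G p - p = V p + (0, P (h p) - (h p).2).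
    by apply: injective_projections => /=; ring.
  rewrite e; have /andP[P1 P2] := Ps (h p); apply: chord_dot_gt0.
  - by rewrite subr_ge0.
  - move=> s0; have sl : 0 < sigma (h p) by lra.
    by have := sV _ sl; have := slec (h p); lra.
  - by rewrite -e subr_eq0; apply/eqP.
have Gg s : 0 <= s <= L -> [/\ G (g s) = g (s + 1) & G (g s) <> g s].
  move=> /andP[s0 sL]; have sN : 0 <= s <= n.+2%:R by rewrite s0 (le_trans sL).
  rewrite -gS//; split=> //; apply: gneq => //.
  by rewrite n3; rewrite n2 in LN; lra.
have g0E : g 0 = (x, 0) by rewrite ge.
have [Gg0 Gn0] := Gg 0 (introT andP (conj (lexx 0) L0)).
pose a0 := pi + turn (V (g 0)) (g 1 - g 0).
have V1 : (V (g 0)).1 < 0 by rewrite g0E /V /= subr_lt0.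
have V2 : (V (g 0)).2 = 0 by rewrite g0E /V /= vy subrr.
have Vpi : arg_of (V (g 0)) pi.
  exists (- (V (g 0)).1); first by rewrite oppr_gt0.
  by rewrite [LHS]surjective_pairing V2 cospi sinpi mulrN1 opprK mulr0.
have d0 : 0 < dot (V (g 0)) (g 1 - g 0).
  by have := Vdot _ Gn0; rewrite Gg0 add0r.
have a0g : arg_of (g 1 - g 0) a0 by exact: arg_of_turn.
have pp := pi_gt0 R.
have a0p : 0 <= a0 <= pi.
  have := turn_gt (V (g 0)) (g 1 - g 0).
  have : turn (V (g 0)) (g 1 - g 0) <= 0.
    rewrite /turn -[X in _ <= X]atan0 le_atan// pmulr_lle0 ?invr_gt0//.
    rewrite /cross V2 mul0r subr0.
    have -> : (g 1 - g 0).2 = c by rewrite g0E ge//= /g0 subr0 mulr1.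
    by rewrite pmulr_lle0// ltW.
  by rewrite /a0 => *; apply/andP; split; lra.
have gneq' s s' : 0 <= s -> s + 1 <= s' -> s' <= 1 + L -> g s' <> g s.
  by rewrite LT => s0 ss sT; apply: gneq => //; exact: le_trans Tn.
have gh s : 0 <= s <= 1 + L -> (g 0).2 <= (g s).2 <= (g (1 + L)).2.
  rewrite LT => /andP[s0 sT]; have sN := le_trans sT Tn.
  by rewrite g0E /= gpos ?s0//= Tmax// in_itv/= s0.
have [Th [Th0 Th1 hTh]] := chord_angle gctn L0 gneq' gh a0g a0p.
have Lt t : 0 <= t <= 1 -> 0 <= L * t <= L.
  by move=> /andP[t1 t2]; rewrite mulr_ge0//= ler_piMr.
have Vclamp p : V (clampy p) = V p by rewrite /V (th_clamp H).
have argV t : 0 <= t <= 1 -> arg_of (V (g (L * t)))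
    (Th t + turn (g (1 + L * t) - g (L * t)) (V (g (L * t)))).
  move=> t01; have [Gs Gn] := Gg _ (Lt _ t01).
  apply: arg_of_turn; first exact: (hTh _ t01).2.
  by have := Vdot _ Gn; rewrite Gs (addrC _ 1) dotC.
have i0 : (0 : R) <= (0 : R) <= (1 : R) by apply/andP.
have i1 : (0 : R) <= (1 : R) <= (1 : R) by apply/andP.
exists (fun t => clampy (g (L * t))),
  (fun t => Th t + turn (g (1 + L * t) - g (L * t)) (V (g (L * t)))); split.
- split.
  + move=> t; have cg : ctn (fun t => g (L * t)) t.
      by apply: (@ctn_comp _ _ _ (fun t : R => L * t) g) => //; ctn_tac.
    by rewrite /clampy; have h1 := ctn_fst cg; have h2 := ctn_snd cg; ctn_tac.
  + by move=> t; exact: clampy_in.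
  + by rewrite mulr0 g0E clampy_bot.
  + by rewrite mulr1 clampy_top.
  + move=> t t01; rewrite Vclamp; split; last exact: argV.
    have [Gs Gn] := Gg _ (Lt _ t01).
    apply: ctnD; first exact: (hTh _ t01).1.
    have cg : ctn (fun t => g (L * t)) t.
      by apply: (@ctn_comp _ _ _ (fun t : R => L * t) g) => //; ctn_tac.
    have cg1 : ctn (fun t => g (1 + L * t)) t.
      by apply: (@ctn_comp _ _ _ (fun t : R => 1 + L * t) g) => //; ctn_tac.
    apply: ctn_turn.
    * by apply: ctn_pair; [exact: ctnD (ctn_fst cg1) (ctnN (ctn_fst cg))
        |exact: ctnD (ctn_snd cg1) (ctnN (ctn_snd cg))].
    * by apply: (@ctn_comp _ _ _ (fun t => g (L * t)) V).
    * by have := Vdot _ Gn; rewrite Gs (addrC _ 1) dotC.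
- have := argV _ i0; rewrite mulr0 => av0; apply: (arg_of_left av0) => //.
  have := turn_gt (g (1 + 0) - g 0) (V (g 0)); have := turn_lt (g (1 + 0) - g 0) (V (g 0)).
  by case/andP: Th0 => *; apply/andP; split; lra.
- have := argV _ i1; rewrite mulr1 => av1; have [v1 v2] := th_top H gL.
  apply: (arg_of_right av1).
  + by rewrite /V /= subr_gt0.
  + by rewrite /V /= v2 subrr.
  have := turn_gt (g (1 + L) - g L) (V (g L)); have := turn_lt (g (1 + L) - g L) (V (g L)).
  by case/andP: Th1 => *; apply/andP; split; lra.
Qed.

End ArcExistence.

(** * Invariant densities forbid dissipation *)

Section MeasureGap.
Context {d : measure_display} {T : measurableType d} {R : realType}.
Variable mu : {measure set T -> \bar R}.
Local Open Scope ereal_scope.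

(** Subtracting the equal finite integrals leaves a null integral of a positive
    function over the difference. *)
Lemma null_of_equal_integrals (A B D : set T) (rho : T -> R) :
  measurable A -> measurable B -> measurable D -> B `<=` A -> A `<=` D ->
  mu.-integrable D (EFin \o rho) ->
  {ae mu, forall x, D x -> (0 < rho x)%R} ->
  \int[mu]_(x in A) (rho x)%:E = \int[mu]_(x in B) (rho x)%:E ->
  mu (A `\` B) = 0.
Proof.
move=> mA mB mD BA AD irho pos eAB.
have mAB : measurable (A `\` B) by exact: measurableD.
have iA : mu.-integrable A (EFin \o rho) by exact: integrableS irho.
have iAB : mu.-integrable (A `\` B) (EFin \o rho).
  by apply: integrableS iA => //; exact: subDsetl.
have iB : mu.-integrable B (EFin \o rho) by exact: integrableS iA.
have mf := measurable_int _ iA.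
have z : \int[mu]_(x in A `\` B) (rho x)%:E = 0.
  have : \int[mu]_(x in B `|` (A `\` B)) (rho x)%:E =
      \int[mu]_(x in B) (rho x)%:E + \int[mu]_(x in A `\` B) (rho x)%:E.
    apply: integral_setU => //; first by rewrite setDUK.
    by apply/disj_setPS; rewrite setDE setIA [B `&` A]setIC -setIA setICr setI0.
  rewrite setDUK// eAB.
  have /fineK <- := integrable_fin_num mB iB.
  have /fineK <- := integrable_fin_num mAB iAB.
  by rewrite -EFinD => -[] e; congr EFin; lra.
have zabs : \int[mu]_(x in A `\` B) `|(rho x)%:E| = 0.
  rewrite -[RHS]z; apply: ae_eq_integral => //.
  - exact: (measurable_int _ (integrable_abse iAB)).
  - exact: (measurable_int _ iAB).
  - apply: filterS pos => x px [Ax _]; rewrite gee0_abs// lee_fin ltW// px//.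
    exact: AD.
have /(ae_eq_integral_abs _ mAB) ae0 := zabs.
have {}ae0 := (ae0 (measurable_int _ iAB)).
apply: measure_negligible => //.
have : {ae mu, forall x, ~ (A `\` B) x}.
  apply: filterS2 pos ae0 => x px ex ABx.
  have [e] := ex ABx; have := px (AD _ ABx.1).
  by rewrite e ltxx.
by move=> [N [mN N0 hN]]; exists N; split=> // x ABx; apply: hN => /(_ ABx).
Qed.

End MeasureGap.

Section AnnulusSets.
Variable R : realType.

Lemma open_square (p : R * R) (B : set (R * R)) : nbhs p B ->
  exists2 e : R, 0 < e & forall q, `|p.1 - q.1| < e -> `|p.2 - q.2| < e -> B q.
Proof.
move/nbhs_ballP => [e e0 he]; exists e => // q q1 q2; apply: he.
by split.
Qed.

Lemma annulus_projP (p q : R * R) : annulus_proj p = annulus_proj q <->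
  exists m : int, p = (q.1 + m%:~R, q.2).
Proof.
split.
  case=> /circle_projP/intrP[m e] e2; exists m; rewrite -e -e2 addrC subrK.
  by case: (p).
move=> [m ->]; congr pair; apply/circle_projP.
by rewrite /= (_ : _ - _ = m%:~R); [apply/intrP; exists m|ring].
Qed.

Lemma int_invariant (W : set (R * R)) :
  (forall x y, W (x, y) -> W (x + 1, y) /\ W (x - 1, y)) ->
  forall (m : int) x y, W (x + m%:~R, y) = W (x, y).
Proof.
move=> Wper m x y; apply: (@int_periodic R _ (fun x => W (x, y))) => u.
by apply/propext; split=> [/Wper[_]|/Wper[]//]; rewrite addrK.
Qed.

Lemma measurable_circle_image (a b : R) :
  measurable (@circle_proj R @` `]a, b[ : set (circle R)).
Proof.
rewrite /measurable /= /circle_measurable /=.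
have -> : circle_proj @^-1` (@circle_proj R @` `]a, b[) =
    \bigcup_n ((`]a + n%:R, b + n%:R[ : set R) `|` `]a - n%:R, b - n%:R[).
  apply/seteqP; split=> x /=.
    move=> [y]; rewrite in_itv/= => /andP[ay yb] /esym/circle_projP/intrP[m xy].
    case: m xy => n xy; [exists n|exists n.+1] => //; [left|right];
      rewrite /= in_itv/=.
      by move: xy; rewrite -pmulrn => xy; apply/andP; split; lra.
    by move: xy; rewrite NegzE mulrNz -pmulrn => xy; apply/andP; split; lra.
  move=> [n _ []]; rewrite /= in_itv/= => /andP[h1 h2].
    exists (x - n%:R); first by rewrite in_itv/=; apply/andP; split; lra.
    by apply/circle_projP/intrP; exists (- n%:Z); rewrite mulrNz -pmulrn; ring.
  exists (x + n%:R); first by rewrite in_itv/=; apply/andP; split; lra.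
  by apply/circle_projP/intrP; exists n%:Z; rewrite -pmulrn; ring.
by apply: bigcupT_measurable => n; apply: measurableU; exact: measurable_itv.
Qed.

(** The image of an open set is a countable union of images of boxes with
    rational corners. *)
Lemma measurable_annulus_image (W : set (R * R)) : open W ->
  measurable (@annulus_proj R @` (W `&` @strip R) : set (circle R * measurableTypeR R)).
Proof.
move=> oW.
pose bx (a b c d : rat) : set (R * R) :=
  [set q | ratr a < q.1 < ratr b /\ ratr c < q.2 < ratr d].
pose piece (a b c d : rat) : set (circle R * measurableTypeR R) :=
  if `[< bx a b c d `<=` W >] then
    (@circle_proj R @` `]ratr a, ratr b[) `*` (`]ratr c, ratr d[ `&` `[0, 1])
  else set0.
have -> : @annulus_proj R @` (W `&` @strip R) =
    \bigcup_a \bigcup_b \bigcup_c \bigcup_d piece a b c d.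
  apply/seteqP; split=> [_ [[x y] [Wp /= y01] <-]|[u v]].
    have [e e0 he] : exists2 e : R, 0 < e & forall q, `|x - q.1| < e ->
        `|y - q.2| < e -> W q.
      by apply: (@open_square (x, y)); apply: open_nbhs_nbhs.
    have rl (z : R) : exists a : rat, z - e < ratr a < z.
      have [|a] := @rat_in_itvoo R (z - e) z; first by lra.
      by rewrite in_itv/=; exists a.
    have rr (z : R) : exists a : rat, z < ratr a < z + e.
      have [|a] := @rat_in_itvoo R z (z + e); first by lra.
      by rewrite in_itv/=; exists a.
    have [a /andP[a1 a2]] := rl x; have [b /andP[b1 b2]] := rr x.
    have [c /andP[c1 c2]] := rl y; have [d /andP[d1 d2]] := rr y.
    exists a => //; exists b => //; exists c => //; exists d => //.
    rewrite /piece asboolT.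
      split=> /=; first by exists x => //; rewrite in_itv/= a2.
      by rewrite !in_itv/= c2.
    move=> [q1 q2] [/andP[h1 h2] /andP[h3 h4]]; move: h1 h2 h3 h4 => /= h1 h2 h3 h4.
    by apply: he; rewrite /= ltr_norml; apply/andP; split; lra.
  move=> [a _ [b _ [c _ [d _]]]]; rewrite /piece; case: asboolP => // sW [/=].
  move=> [x]; rewrite in_itv/= => xab <- []; rewrite !in_itv/= => vcd v01.
  by exists (x, v) => //; split=> //; exact: sW.
do 4! (apply: bigcupT_measurable_rat => ?).
rewrite /piece; case: ifP => _; last exact: measurable0.
apply: measurableX; first exact: measurable_circle_image.
by apply: measurableI; exact: measurable_itv.
Qed.

Lemma measurable_annulus : measurable (@annulus R : set (circle R * measurableTypeR R)).
Proof.
have -> : @annulus R = setT `*` `[0, 1].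
  by apply/seteqP; split=> -[x y] /=; rewrite in_itv//= => -[].
by apply: measurableX => //; exact: measurable_itv.
Qed.

Lemma annulus_measure_box_gt0 (x y e : R) : 0 < e ->
  (0 < annulus_measure ((@circle_proj R @` `](x - e)%R, (x + e)%R[) `*`
    `](y - e)%R, (y + e)%R[))%E.
Proof.
move=> e0; rewrite /annulus_measure product_measure1E; last 2 first.
- exact: measurable_circle_image.
- exact: measurable_itv.
apply: mule_gt0; last first.
  suff : (0 < @lebesgue_measure R `](y - e)%R, (y + e)%R[)%E by [].
  rewrite lebesgue_measure_itv/= lte_fin ifT; last by lra.
  by rewrite -EFinB lte_fin; lra.
pose z := x - (Num.floor x)%:~R.
have [z0 z1] : 0 <= z /\ z < 1.
  have := floor_le_tmp x; have := floorD1_gt x.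
  by rewrite /z intrD => h1 h2; split; lra.
pose w := Num.min (z + e) 1.
have zw : z < w by rewrite lt_min z1 andbT ltrDl.
have [we w1] : w <= z + e /\ w <= 1 by rewrite /w !ge_min !lexx orbT.
apply: (@lt_le_trans _ _ (@lebesgue_measure R `]z, w[)).
  by rewrite lebesgue_measure_itv/= lte_fin zw -EFinB lte_fin subr_gt0.
apply: le_measure; rewrite ?inE.
- exact: measurable_itv.
- by apply: measurableI; [exact: measurable_circle_image|exact: measurable_itv].
move=> t; rewrite /= !in_itv/= => /andP[zt tw]; split; last first.
  by apply/andP; split; lra.
exists (t + (Num.floor x)%:~R).
  by rewrite in_itv/=; apply/andP; rewrite /z in zt we; split; lra.
by apply/circle_projP/intrP; exists (Num.floor x); ring.
Qed.

End AnnulusSets.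

Section Nondissipative.
Variables (R : realType) (h k : R * R -> R * R) (dmu : circle R * R -> R).
Hypothesis hK : cancel h k.
Hypothesis kK : cancel k h.
Hypothesis k_ctn : forall p, ctn k p.
Hypothesis h_per : forall x y, h (x + 1, y) = ((h (x, y)).1 + 1, (h (x, y)).2).
Hypothesis dmu_int :
  (@annulus_measure R).-integrable (@annulus R) (EFin \o dmu).
Hypothesis dmu_gt0 : {ae @annulus_measure R, forall p, annulus p -> 0 < dmu p}.

Lemma open_image (W : set (R * R)) : open W -> open (h @` W).
Proof.
move=> oW; have -> : h @` W = k @^-1` W.
  apply/seteqP; split=> [_ [q Wq <-]|q Wq] /=; first by rewrite hK.
  by exists (k q).
by apply: open_comp => // q _; exact: k_ctn.
Qed.

Lemma image_invariant (W : set (R * R)) :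
  (forall x y, W (x, y) -> W (x + 1, y) /\ W (x - 1, y)) ->
  forall x y, (h @` W) (x, y) -> (h @` W) (x + 1, y) /\ (h @` W) (x - 1, y).
Proof.
move=> Wper x y [[u v] /Wper[W1 W2] e]; split.
  by exists (u + 1, v) => //; rewrite h_per e.
exists (u - 1, v) => //; have := h_per (u - 1) v; rewrite subrK e => -[-> ->].
by rewrite addrK -surjective_pairing.
Qed.

(** If the image of an open set [W] omitted a box inside [W], the images of [W]
    and of [h @` W] in the annulus would have the same integral, which is finite,
    although their difference contains the nonnull image of the box. *)
Lemma nondissipative_of_invariant :
  (forall W : set (R * R), open W -> (forall x y, W (x, y) -> W (x + 1, y) /\ W (x - 1, y)) ->
    (\int[@annulus_measure R]_(p in @annulus_proj R @` (W `&` @strip R)) (dmu p)%:E =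
     \int[@annulus_measure R]_(p in @annulus_proj R @` (h @` W `&` @strip R)) (dmu p)%:E)%E) ->
  nondissipative h.
Proof.
move=> hinv W oW Wper Wh p Wp /andP[p0 p1] B nB; apply: contrapT => dis.
have nB' : nbhs p (B `&` (W `&` [set q | 0 < q.2 < 1])).
  apply: filterI => //; apply: filterI; first exact: open_nbhs_nbhs.
  have n0 : \forall q \near p, 0 < q.2.
    by apply: (@near_lt_ctn R _ (fun=> 0) (fun q : R * R => q.2)) => //; ctn_tac.
  have n1 : \forall q \near p, q.2 < 1.
    by apply: (@near_lt_ctn R _ (fun q : R * R => q.2) (fun=> 1)) => //; ctn_tac.
  by apply: filterS2 n0 n1 => q /= -> ->.
have [e e0 he] := open_square nB'.
pose U : set (circle R * measurableTypeR R) := @annulus_proj R @` (W `&` @strip R).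
pose U' : set (circle R * measurableTypeR R) := @annulus_proj R @` (h @` W `&` @strip R).
have UU : U' `<=` U.
  by move=> _ [q [[q' Wq' <-] sq] <-]; exists (h q') => //; split=> //; exact: Wh.
have UA : U `<=` @annulus R by move=> _ [q [_ sq] <-].
have mU : measurable U by exact: measurable_annulus_image.
have mU' : measurable U' by apply: measurable_annulus_image; exact: open_image.
have nul := null_of_equal_integrals mU mU' (@measurable_annulus R) UU UA dmu_int
  dmu_gt0 (hinv W oW Wper).
have := annulus_measure_box_gt0 p.1 p.2 e0; rewrite ltNge -nul => /negP; apply.
apply: le_measure; rewrite ?inE.
- by apply: measurableX; [exact: measurable_circle_image|exact: measurable_itv].
- exact: measurableD.
move=> [u v] [/= [x]]; rewrite !in_itv/= => /andP[x1 x2] <- /andP[v1 v2].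
have [Bq [Wq /= /andP[q0 q1]]] : (B `&` (W `&` [set q | 0 < q.2 < 1])) (x, v).
  by apply: he => /=; rewrite ltr_norml; apply/andP; split; lra.
split; first by exists (x, v) => //; split=> //; rewrite /strip /= !ltW.
move=> [q [hWq _] eq]; have /annulus_projP[m] : annulus_proj q = annulus_proj (x, v).
  by [].
case: q hWq {eq} => q1' q2' hWq [e1 e2].
move: e1 e2 => /= e1 e2; have hW : (h @` W) (x, v).
  by rewrite -(int_invariant (image_invariant Wper) m) -e1 -e2.
by apply: dis; exists (x, v).
Qed.

End Nondissipative.

(** * Lifts of annulus maps *)

Section Lift.
Variables (R : realType) (f g : circle R * R -> circle R * R) (F : R * R -> R * R).
Hypothesis f_annulus : set_fun (@annulus R) (@annulus R) f.
Hypothesis g_annulus : set_fun (@annulus R) (@annulus R) g.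
Hypothesis fgK : forall p, annulus p -> g (f p) = p /\ f (g p) = p.
Hypothesis f_boundary0 : f @` boundary 0 = boundary 0.
Hypothesis f_boundary1 : f @` boundary 1 = boundary 1.
Hypothesis F_lift : is_lift f F.
Hypothesis F_twist : twist_lift F.

Let F_strip p : strip p -> strip (F p).
Proof. by case: F_lift => sF _ _ /sF. Qed.

Let F_proj p : strip p -> annulus_proj (F p) = f (annulus_proj p).
Proof. by case: F_lift => _ _; apply. Qed.

Let strip_annulus (p : R * R) : strip p -> annulus (annulus_proj p).
Proof. by []. Qed.

Let clampy_strip (p : R * R) : strip (clampy p).
Proof. exact: clampy_in. Qed.

Let Fc p := F (clampy p).

Lemma ctn_clampy (p : R * R) : ctn (@clampy R) p.
Proof. by rewrite /clampy; ctn_tac. Qed.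

Let Fc_ctn p : ctn Fc p.
Proof.
case: F_lift => _ cF _.
have cFp : F @ within (@strip R) (nbhs (clampy p)) --> F (clampy p).
  by rewrite nbhs_subspace_in//; exact: cF.
have cw : @clampy R @ nbhs p --> within (@strip R) (nbhs (clampy p)).
  move=> B; rewrite /within /= => nB.
  have nC : nbhs p [set q | strip (clampy q) -> B (clampy q)] := ctn_clampy (p := p) nB.
  rewrite /nbhs /=; suff : nbhs p (@clampy R @^-1` B) by [].
  by apply: filterS nC => q; apply; exact: clampy_strip.
exact: cvg_comp cw cFp.
Qed.

Lemma lift_ctn p : ctn (fun p => F (clampy p)) p.
Proof. exact: Fc_ctn. Qed.

Let F_injproj p q : strip p -> strip q -> annulus_proj (F p) = annulus_proj (F q) ->
  annulus_proj p = annulus_proj q.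
Proof.
move=> sp sq; rewrite !F_proj// => e.
by rewrite -(proj1 (fgK (strip_annulus sp))) e (proj1 (fgK (strip_annulus sq))).
Qed.

(** The lift commutes with the deck translation up to a constant degree, by
    continuity, and the twist on the bottom line forces degree one. *)
Lemma lift_degree : forall p, strip p -> F (p.1 + 1, p.2) = ((F p).1 + 1, (F p).2).
Proof.
pose D (p : R * R) := (Fc (p.1 + 1, p.2)).1 - (Fc p).1.
have Dint p : exists m : int, D p = m%:~R /\ (Fc (p.1 + 1, p.2)).2 = (Fc p).2.
  have e : annulus_proj (Fc (p.1 + 1, p.2)) = annulus_proj (Fc p).
    rewrite /Fc !F_proj//; congr f; apply/annulus_projP; exists 1.
    by rewrite /clampy /=.
  have /annulus_projP[m E] := e; exists m.
  by rewrite /D E /=; split=> //; ring.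
have Dc p : ctn D p.
  have c1 : ctn (fun p : R * R => Fc (p.1 + 1, p.2)) p.
    apply: (@ctn_comp _ _ _ (fun p : R * R => (p.1 + 1, p.2)) Fc) => //; ctn_tac.
  by rewrite /D; apply: ctnD; [exact: (ctn_fst c1)|apply: ctnN; exact: (ctn_fst (Fc_ctn (p := p)))].
have pp := pi_gt0 R.
(* [D] takes integer values, so that [2 * pi * D] is constant by continuity. *)
have Dcst p : D p = D (0, 0).
  pose z (t : R) : R * R := (t * p.1, t * p.2).
  have := @cos_eq1_constant R (fun t => 2 * pi * D (z t)).
  have -> : z 0 = (0, 0) by rewrite /z !mul0r.
  have -> : z 1 = p by rewrite /z !mul1r; case: (p).
  move=> h; apply/esym/(mulfI (x := 2 * pi)).
    by rewrite mulf_neq0// ?pnatr_eq0// gt_eqF.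
  apply: h => t _.
    apply: ctnM; first exact: ctn_cst.
    by apply: (@ctn_comp _ _ _ z D) => //; rewrite /z; ctn_tac.
  by have [m [-> _]] := Dint (z t); exact: cos_int.
have [d [dE _]] := Dint (0, 0).
have strip0 x : strip (x, 0 : R) by rewrite /strip /= lexx ler01.
have F0 (m : int) : (F (m%:~R, 0)).1 = (F (0, 0)).1 + d%:~R * m%:~R.
  have := @int_periodic R _ (fun x => (F (x, 0)).1 - d%:~R * x) _ m 0.
  rewrite add0r mulr0 subr0 => <-; first by rewrite subrK.
  move=> x; have := Dcst (x, 0); rewrite dE /D /Fc /= !clampy_id ?lexx ?ler01//.
  by move=> e; lra.
have d1 : d = 1.
  apply/eqP; rewrite eq_le; apply/andP; split; rewrite leNgt; apply/negP => hd.
    pose N := Num.bound `|(F (0, 0)).1|.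
    have hN : `|(F (0, 0)).1| < N%:R.
      by apply: archi_boundP.
    have := (F_twist (N%:Z)%:~R).1; rewrite F0.
    have : 2 <= d%:~R :> R by rewrite -[2]/(2%:~R) ler_int; lia.
    have := ler_norm (- (F (0, 0)).1); rewrite normrN -pmulrn.
    have : 0 <= N%:R :> R by [].
    by nra.
  pose N := Num.bound `|(F (0, 0)).1|.
  have hN : `|(F (0, 0)).1| < N%:R.
    by apply: archi_boundP.
  have := (F_twist (- N%:Z)%:~R).1; rewrite F0 mulrNz.
  have : d%:~R <= 0 :> R by rewrite -[0]/(0%:~R) ler_int; lia.
  have := ler_norm (- (F (0, 0)).1); rewrite normrN -pmulrn.
  have : 0 <= N%:R :> R by [].
  by nra.
move=> p sp; have := Dcst p; have [m [_ e2]] := Dint p.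
rewrite dE d1 /D; move: e2; rewrite /Fc !clampy_id//= => e2 e1.
by apply: injective_projections => //=; lra.
Qed.

Let F_int (m : int) x y : 0 <= y <= 1 ->
  F (x + m%:~R, y) = ((F (x, y)).1 + m%:~R, (F (x, y)).2).
Proof.
move=> y01; pose u x := ((F (x, y)).1 - x, (F (x, y)).2).
have uE : u (x + m%:~R) = u x.
  by apply: int_periodic => t; rewrite /u (@lift_degree (t, y))//=; congr (_, _); ring.
by move: uE => [e1 e2]; apply: injective_projections => //=; lra.
Qed.

Lemma lift_inj p q : strip p -> strip q -> F p = F q -> p = q.
Proof.
move=> sp sq e; have /annulus_projP[m pE] : annulus_proj p = annulus_proj q.
  by apply: F_injproj => //; rewrite e.
move: e; rewrite pE F_int//; case: q sq pE => q1 q2 _ _ /= /(congr1 fst) /= => e.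
by congr (_, _); lra.
Qed.

(** The lift is surjective because [f] is: a preimage in the annulus lifts to a
    preimage up to an integer translation. *)
Lemma lift_surj q : strip q -> exists2 p, strip p & F p = q.
Proof.
move=> sq; have ag := g_annulus (strip_annulus sq).
pose r := g (annulus_proj q).
have [x xE] : exists x, circle_proj x = r.1.
  by exists (repr r.1); rewrite /circle_proj reprK.
have sp : strip (x, r.2) by exact: ag.
have e : annulus_proj (F (x, r.2)) = annulus_proj q.
  rewrite F_proj// /annulus_proj xE /= -surjective_pairing.
  by rewrite (proj2 (fgK (strip_annulus sq))).
have /annulus_projP[m E] := e.
exists (x + (- m)%:~R, r.2) => //; rewrite F_int// E /= mulrNz addrK.
by case: (q).
Qed.

Lemma lift_bottom x : (F (x, 0)).2 = 0.
Proof.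
have s0 : strip (x, 0 : R) by rewrite /strip /= lexx ler01.
have : boundary 0 (f (annulus_proj (x, 0))) by rewrite -f_boundary0; exists (annulus_proj (x, 0)).
by rewrite -F_proj.
Qed.

Lemma lift_top x : (F (x, 1)).2 = 1.
Proof.
have s0 : strip (x, 1 : R) by rewrite /strip /= lexx ler01.
have : boundary 1 (f (annulus_proj (x, 1))) by rewrite -f_boundary1; exists (annulus_proj (x, 1)).
by rewrite -F_proj.
Qed.

Lemma lift_boundary b p : 0 <= b <= 1 -> f @` boundary b = boundary b ->
  strip p -> (F p).2 = b -> p.2 = b.
Proof.
move=> b01 fb sp e; have : boundary b (annulus_proj (F p)) by [].
rewrite -fb F_proj// => -[r rb fr].
have ar : annulus r by rewrite /annulus /= rb.
have : annulus_proj p = r.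
  by rewrite -(proj1 (fgK (strip_annulus sp))) -fr (proj1 (fgK ar)).
by move=> /(congr1 snd) /= ->.
Qed.

Lemma lift_mid p : 0 < p.2 < 1 -> 0 < (F p).2 < 1.
Proof.
move=> /andP[p0 p1]; have sp : strip p by rewrite /strip /= !ltW.
have /andP[f0 f1] : 0 <= (F p).2 <= 1 := F_strip sp.
rewrite !lt_neqAle f0 f1 !andbT eq_sym; apply/andP; split; apply/eqP => e.
  have := lift_boundary _ f_boundary0 sp e; rewrite lexx ler01 => /(_ isT) e0.
  by rewrite e0 ltxx in p0.
have := lift_boundary _ f_boundary1 sp e; rewrite lexx ler01 => /(_ isT) e0.
by rewrite e0 ltxx in p1.
Qed.

End Lift.

(** * Extension of a twist lift to the plane *)

(** A bijection of the plane at bounded distance from the identity is proper. *)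
Lemma proper_inverse_ctn (R : realType) (h k : R * R -> R * R) (B : R) :
  (forall p, ctn h p) -> cancel h k -> cancel k h ->
  (forall p, `|(h p).1 - p.1| <= B /\ `|(h p).2 - p.2| <= B) ->
  forall q, ctn k q.
Proof.
move=> hc hK kK hB q N nN; have [e e0 he] := open_square nN.
pose I (z : R) := `[z - (B + 1), z + (B + 1)]%classic.
pose C := (I q.1 `*` I q.2) `&`
  [set p | e <= Num.max `|p.1 - (k q).1| `|p.2 - (k q).2|].
have cC : compact C.
  apply: compact_closedI; first by apply: compact_setX; exact: segment_compact.
  apply: (@closed_le_ctn R _ (fun=> e)
    (fun p : R * R => Num.max `|p.1 - (k q).1| `|p.2 - (k q).2|)) => p; ctn_tac.
have [||m m0 hm] := @compact_positive_bound R _ _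
  (fun p => Num.max `|(h p).1 - q.1| `|(h p).2 - q.2|) cC.
- by move=> p; have hcp := hc p; ctn_tac.
- move=> p [_ /= ep]; rewrite lt_max !normr_gt0 !subr_eq0 -negb_and.
  apply/negP => /andP[/eqP e1 /eqP e2]; move: ep.
  have <- : p = k q by rewrite -[p]hK; congr k; exact: injective_projections.
  by rewrite !subrr normr0 maxxx leNgt e0.
pose m' := Num.min m 1.
have [mm m1] : m' <= m /\ m' <= 1 by rewrite /m' !ge_min !lexx orbT.
have m'0 : 0 < m' by rewrite lt_min m0 ltr01.
have n1 : \forall z \near q, `|z.1 - q.1| < m'.
  apply: (@near_lt_ctn R _ (fun z : R * R => `|z.1 - q.1|) (fun=> m')); try ctn_tac.
  by rewrite subrr normr0.
have n2 : \forall z \near q, `|z.2 - q.2| < m'.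
  apply: (@near_lt_ctn R _ (fun z : R * R => `|z.2 - q.2|) (fun=> m')); try ctn_tac.
  by rewrite subrr normr0.
suff : nbhs q (k @^-1` N) by [].
apply: filterS2 n1 n2 => z z1 z2; have [] := hB (k z); rewrite kK => b1 b2.
have [zf|zf] := ltP (Num.max `|(k z).1 - (k q).1| `|(k z).2 - (k q).2|) e.
  by move: zf; rewrite gt_max => /andP[h1 h2]; apply: he; rewrite distrC.
have Cz : C (k z).
  split=> //; move: z1 z2 b1 b2; rewrite !ltr_norml !ler_norml.
  move=> /andP[? ?] /andP[? ?] /andP[? ?] /andP[? ?].
  by split; rewrite /I /= in_itv/=; apply/andP; split; lra.
have := hm _ Cz; rewrite kK leNgt gt_max.
by rewrite (lt_le_trans z1 mm) (lt_le_trans z2 mm).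
Qed.

Section Extension.
Variables (R : realType) (F : R * R -> R * R).
Hypothesis F_ctn : forall p, ctn (fun p => F (clampy p)) p.
Hypothesis F_strip : forall p, strip p -> strip (F p).
Hypothesis F_per : forall p, strip p -> F (p.1 + 1, p.2) = ((F p).1 + 1, (F p).2).
Hypothesis F_inj : forall p q, strip p -> strip q -> F p = F q -> p = q.
Hypothesis F_surj : forall q, strip q -> exists2 p, strip p & F p = q.
Hypothesis F_bot : forall x, (F (x, 0)).2 = 0.
Hypothesis F_top : forall x, (F (x, 1)).2 = 1.
Hypothesis F_mid : forall p, 0 < p.2 < 1 -> 0 < (F p).2 < 1.
Hypothesis F_twist : twist_lift F.

Let h (p : R * R) : R * R :=
  ((F (clampy p)).1, (F (clampy p)).2 + (p.2 - (clampy p).2)).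

Let h_strip p : strip p -> h p = F p.
Proof. by move=> sp; rewrite /h clampy_id// subrr addr0 -surjective_pairing. Qed.

Let h_bot p : p.2 <= 0 -> h p = ((F (p.1, 0)).1, p.2).
Proof. by move=> p0; rewrite /h clampy_bot// F_bot add0r subr0. Qed.

Let h_top p : 1 <= p.2 -> h p = ((F (p.1, 1)).1, p.2).
Proof. by move=> p1; rewrite /h clampy_top// F_top addrC subrK. Qed.

Let region (p : R * R) : [\/ p.2 <= 0, 0 < p.2 < 1 | 1 <= p.2].
Proof.
have [p0|p0] := leP p.2 0; first by apply: Or31.
by have [p1|p1] := leP 1 p.2; [apply: Or33|apply: Or32].
Qed.

Let mid_strip (p : R * R) : 0 < p.2 < 1 -> strip p.
Proof. by move=> /andP[p0 p1]; rewrite /strip /= !ltW. Qed.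

Let strip0 x : strip (x, 0 : R). Proof. by rewrite /strip /= lexx ler01. Qed.
Let strip1 x : strip (x, 1 : R). Proof. by rewrite /strip /= lexx ler01. Qed.

Let h_mid p : 0 < p.2 < 1 -> 0 < (h p).2 < 1.
Proof. by move=> pm; rewrite h_strip ?F_mid//; exact: mid_strip. Qed.

Let h_inj : injective h.
Proof.
move=> p q e.
have same b p' q' : F (p'.1, b) = F (q'.1, b) -> 0 <= b <= 1 -> p'.2 = q'.2 -> p' = q' :> R * R.
  move=> eF b01 e2; have [] := F_inj (p := (p'.1, b)) (q := (q'.1, b)) b01 b01 eF.
  by move=> e1; exact: injective_projections.
have h2 u : [\/ u.2 <= 0 /\ (h u).2 <= 0, 0 < u.2 < 1 /\ 0 < (h u).2 < 1 | 1 <= u.2 /\ 1 <= (h u).2].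
  case: (region u) => hu; [apply: Or31|apply: Or32|apply: Or33]; split=> //.
  - by rewrite h_bot.
  - exact: h_mid.
  - by rewrite h_top.
case: (h2 p) => -[p2 hp]; case: (h2 q) => -[q2 hq]; rewrite e in hp.
- move: e; rewrite !h_bot// => -[e1 e2]; apply: (same 0) => //.
    by apply: injective_projections; rewrite ?F_bot.
  by rewrite lexx ler01.
- by exfalso; clear e; case/andP: hq => ? ?; lra.
- by exfalso; clear e; lra.
- by exfalso; clear e; case/andP: hp => ? ?; lra.
- by move: e; rewrite !h_strip; try exact: mid_strip; apply: F_inj; exact: mid_strip.
- by exfalso; clear e; case/andP: hp => ? ?; lra.
- by exfalso; clear e; lra.
- by exfalso; clear e; case/andP: hq => ? ?; lra.
- move: e; rewrite !h_top// => -[e1 e2]; apply: (same 1) => //.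
    by apply: injective_projections; rewrite ?F_top.
  by rewrite ler01 lexx.
Qed.

Let h_surj q : exists p, h p = q.
Proof.
case: (region q) => hq.
- have [[x y] sp e] := F_surj (strip0 q.1).
  have y0 : y = 0.
    case: (region (x, y)) => /= yr.
    - by apply: le_anti; rewrite yr; case/andP: sp.
    - by have := F_mid (p := (x, y)) yr; rewrite e ltxx.
    - have y1 : y = 1 by apply: le_anti; rewrite yr andbT; case/andP: sp.
      by move: (F_top x); rewrite -{1}y1 e /= => /eqP; rewrite eq_sym oner_eq0.
  by rewrite y0 in e; exists (x, q.2); rewrite h_bot//= e /= -surjective_pairing.
- by have [p sp e] := F_surj (mid_strip hq); exists p; rewrite h_strip.
- have [[x y] sp e] := F_surj (strip1 q.1).
  have y1 : y = 1.
    case: (region (x, y)) => /= yr.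
    - have y0 : y = 0 by apply: le_anti; rewrite yr; case/andP: sp.
      by move: (F_bot x); rewrite -{1}y0 e /= => /eqP; rewrite oner_eq0.
    - by have := F_mid (p := (x, y)) yr; rewrite e ltxx andbF.
    - by apply: le_anti; rewrite yr andbT; case/andP: sp.
  by rewrite y1 in e; exists (x, q.2); rewrite h_top//= e /= -surjective_pairing.
Qed.

Let h_ctn p : ctn h p.
Proof.
have c := @F_ctn p; rewrite /h; apply: ctn_pair; first exact: (ctn_fst c).
apply: ctnD; first exact: (ctn_snd c).
by rewrite /clampy /=; ctn_tac.
Qed.

Let h_per x y : h (x + 1, y) = ((h (x, y)).1 + 1, (h (x, y)).2).
Proof.
have e := F_per (p := clampy (x, y)) (clampy_in _).
by rewrite /h (_ : clampy (x + 1, y) = ((clampy (x, y)).1 + 1, (clampy (x, y)).2))// e.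
Qed.

Let h_clamp p : h (clampy p) - clampy p = h p - p.
Proof.
rewrite h_strip; last exact: clampy_in.
by apply: injective_projections => //=; ring.
Qed.

Let h_bounded : exists B, forall p,
  `|(h p).1 - p.1| <= B /\ `|(h p).2 - p.2| <= B.
Proof.
have b0 : strip_box (0 : R) 1 !=set0.
  by exists (0, 0); split; rewrite /= lexx ler01.
have [|c _ hc] := compact_EVT_max
    (f := fun p => Num.max `|(h p).1 - p.1| `|(h p).2 - p.2|) b0 (@compact_strip_box R 0 1).
  apply: continuous_subspaceT => p; have hcp := @h_ctn p.
  suff : ctn (fun p => Num.max `|(h p).1 - p.1| `|(h p).2 - p.2|) p by [].
  ctn_tac.
exists (Num.max `|(h c).1 - c.1| `|(h c).2 - c.2|) => p.
apply/andP; rewrite -ge_max.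
have [i pi] := to_fundamental 0 p.1.
pose u x := ((h (x, (clampy p).2)).1 - x, (h (x, (clampy p).2)).2 - (clampy p).2).
have uE : u (p.1 + i%:~R) = u p.1.
  by apply: int_periodic => t; rewrite /u h_per /=; congr (_, _); ring.
have [v1 v2] : h p - p = u p.1 by rewrite -h_clamp.
have [w1 w2] := uE.
move: v1 v2 => /= v1 v2; rewrite v1 v2 -w1 -w2.
apply: (hc (p.1 + i%:~R, (clampy p).2)); rewrite inE; split; last exact: clampy_in.
by move: pi; rewrite add0r.
Qed.

Lemma extension : exists h' k', twist_homeo h' k' /\ forall p, strip p -> h' p = F p.
Proof.
have [k kK] : exists k, cancel k h.
  exists (fun q => projT1 (cid (h_surj q))) => q.
  by case: cid.
have hK : cancel h k by move=> p; apply: h_inj; rewrite kK.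
exists h, k; split; last exact: h_strip.
have [B hB] := h_bounded; split=> //.
- exact: (@proper_inverse_ctn R h k B).
- by move=> p p0; rewrite h_bot//; split=> //; exact: (F_twist p.1).1.
- by move=> p p1; rewrite h_top//; split=> //; exact: (F_twist p.1).2.
Qed.

End Extension.

(** * Contradiction from a single fixed point *)

Section SingleFixedPoint.
Variable R : realType.

(** The zeros of [kappa] are the first coordinates of the fixed points: there are
    none, or they form one translate of the integers. The function serves as a
    periodic substitute for the distance to them. *)
Definition fixed_point_data (h : R * R -> R * R) (kappa : R -> R) (x0 y0 xc : R) :=
  [/\ [/\ forall x, ctn kappa x, forall x, 0 <= kappa x,
        forall x, kappa (x + 1) = kappa x & 1 <= kappa xc],
      forall x x' t, x0 <= x <= x0 + 1 -> x0 <= x' <= x0 + 1 ->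
        0 <= t <= 1 -> Num.min (kappa x) (kappa x') <= kappa (x + t * (x' - x)),
      0 < y0 < 1 &
      forall p, 0 <= p.2 <= 1 -> h p = p <-> (kappa p.1 = 0 /\ p.2 = y0)].

Lemma cos_turn_le (u v : R) : 0 <= u -> u <= v -> v <= 1 / 2 ->
  cos (2 * pi * v) <= cos (2 * pi * u).
Proof.
have pp := pi_gt0 R; move=> u0 uv v1.
have vv : 2 * pi * v <= pi by nra.
have uu : 2 * pi * u <= 2 * pi * v by rewrite ler_wpM2l// mulr_ge0// ltW.
have u00 : 0 <= 2 * pi * u by rewrite mulr_ge0// mulr_ge0// ltW.
rewrite leNgt; apply/negP => hlt.
have := @ltr_cos R (2 * pi * v) (2 * pi * u); rewrite !in_itv/= hlt.
rewrite u00 vv (le_trans uu vv) (le_trans u00 uu) => /(_ isT isT)/esym.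
by rewrite ltNge uu.
Qed.

Lemma cos_turn_sym (u : R) : cos (2 * pi * (1 - u)) = cos (2 * pi * u).
Proof. by rewrite -[RHS]cosN -[RHS]cosD2pi mulr2n; congr cos; ring. Qed.

(** On one period the cosine decreases and then increases. *)
Lemma cos_turn_quasiconvex (u u' t : R) : 0 <= u <= 1 -> 0 <= u' <= 1 ->
  0 <= t <= 1 ->
  cos (2 * pi * (u + t * (u' - u))) <=
  Num.max (cos (2 * pi * u)) (cos (2 * pi * u')).
Proof.
wlog uu : u u' t / u <= u' => [hw|].
  move=> hu hu' /andP[t0 t1]; have [|/ltW le'] := leP u u'.
    by move=> le'; apply: hw; rewrite ?t0.
  rewrite maxC (_ : u + t * (u' - u) = u' + (1 - t) * (u - u')); last by ring.
  by apply: hw => //; apply/andP; split; lra.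
move=> /andP[u0 u1] /andP[u0' u1'] /andP[t0 t1].
have d0 : 0 <= u' - u by rewrite subr_ge0.
have m1 : 0 <= t * (u' - u) by rewrite mulr_ge0.
have m2 : t * (u' - u) <= u' - u by rewrite ler_piMl.
rewrite le_max; have [h|h] := leP (u + t * (u' - u)) (1 / 2).
  by apply/orP; left; apply: cos_turn_le => //; rewrite lerDl.
apply/orP; right; rewrite -cos_turn_sym -[leRHS]cos_turn_sym.
by apply: cos_turn_le; lra.
Qed.

(** With a fixed point over [x0] one takes [kappa x = 1 - cos (2 * pi * (x - x0))];
    without fixed points the constant function 1 will do. *)
Lemma at_most_one_data (h k : R * R -> R * R) : twist_homeo h k ->
  (forall p q, 0 <= p.2 <= 1 -> 0 <= q.2 <= 1 -> h p = p -> h q = q ->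
    exists m : int, p = (q.1 + m%:~R, q.2)) ->
  exists kappa x0 y0 xc, fixed_point_data h kappa x0 y0 xc.
Proof.
move=> H fix1; have pp := pi_gt0 R.
have [[p0 [p02 hp0]]|nofix] := pselect (exists p, 0 <= p.2 <= 1 /\ h p = p);
    last first.
  exists (fun=> 1), 0, (1 / 2), 0; split.
  - by split=> // x; exact: ctn_cst.
  - by move=> *; rewrite minxx.
  - by apply/andP; split; lra.
  - move=> p p2; split=> [hp|[/eqP]]; last by rewrite oner_eq0.
    by case: nofix; exists p.
exists (fun x => 1 - cos (2 * pi * (x - p0.1))), p0.1, p0.2, (p0.1 + 1 / 2).
have per : forall x, 1 - cos (2 * pi * (x + 1 - p0.1)) = 1 - cos (2 * pi * (x - p0.1)) :> R.
  by move=> x; rewrite -[in RHS]cosD2pi mulr2n; congr (1 - cos _); ring.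
split.
- split=> //.
  + move=> x; apply: ctnD; first exact: ctn_cst.
    apply: ctnN; apply: (@ctn_comp _ _ _ (fun x => 2 * pi * (x - p0.1)) cos).
      exact: continuous_cos.
    by ctn_tac.
  + rewrite (_ : 2 * pi * _ = pi); first by rewrite cospi; lra.
    by field.
- move=> x x' t /andP[x1 x2] /andP[x1' x2'] t01.
  have q := @cos_turn_quasiconvex (x - p0.1) (x' - p0.1) t.
  have {q} : cos (2 * pi * (x + t * (x' - x) - p0.1)) <=
      Num.max (cos (2 * pi * (x - p0.1))) (cos (2 * pi * (x' - p0.1))).
    rewrite (_ : x + t * (x' - x) - p0.1 =
      x - p0.1 + t * (x' - p0.1 - (x - p0.1))); last by ring.
    by apply: q => //; apply/andP; split; lra.
  by rewrite le_max => /orP[] hh; rewrite ge_min; apply/orP; [left|right]; lra.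
- rewrite !lt_neqAle; case/andP: p02 => -> ->; rewrite !andbT.
  apply/andP; split; apply/eqP => e.
    have [] := th_bot H (p := p0); first by rewrite -e.
    by rewrite hp0 ltxx.
  have [] := th_top H (p := p0); first by rewrite e.
  by rewrite hp0 ltxx.
- move=> p p2; split.
    move=> hp; have [m ->] := fix1 _ _ p2 p02 hp hp0; split=> //=.
    by rewrite [_ + _ - _]addrAC subrr add0r cos_int subrr.
  move=> [/eqP]; rewrite subr_eq0 eq_sym => /eqP/cos_eq1_int[m e] e2.
  have pE : p = (p0.1 + m%:~R, p0.2).
    by rewrite -e -e2 addrC subrK; case: (p).
  pose u x := ((h (x, p0.2)).1 - x, (h (x, p0.2)).2).
  have uE : u (p0.1 + m%:~R) = u p0.1.
    by apply: int_periodic => x; rewrite /u (th_per H) /=; congr (_, _); ring.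
  move: uE; rewrite /u -pE -surjective_pairing hp0 => -[e1 e3].
  by apply: injective_projections; rewrite ?e3 ?e2//; lra.
Qed.

(** The arcs obtained from [h] and from the reflected inverse turn by half a
    turn in opposite directions, although the angle at the top is the same for
    all arcs. *)
Lemma single_fixed_point_absurd (h k : R * R -> R * R) kappa x0 y0 xc :
  twist_homeo h k -> nondissipative h -> nondissipative k ->
  fixed_point_data h kappa x0 y0 xc -> False.
Proof.
move=> H nh nk [[kc k0 kp kx] kq yi fx].
pose V p := h p - p.
have [g [th [ga th0 th1]]] : exists g th, [/\ angle_arc V g th, th 0 = pi & th 1 = 0].
  by apply: (@turning_arc R h k kappa y0 xc) => // p p2 hp; exact/fx.
pose h' := @reflx R \o k \o @reflx R.
have H' := twist_homeo_reflV H.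
pose V' p := h' p - p.
have [g' [th' [ga' th0' th1']]] : exists g th, [/\ angle_arc V' g th, th 0 = pi & th 1 = 0].
  apply: (@turning_arc R h' _ (fun x => kappa (- x)) y0 (- xc) H') => //.
  - exact: nondissipative_reflV nk.
  - move=> x; apply: (@ctn_comp _ _ _ (fun x => - x) kappa); first exact: kc.
    by ctn_tac.
  - by move=> x; rewrite -(kp (- (x + 1))) opprD subrK.
  - by rewrite opprK.
  - move=> p p2 hp; apply: (iffLR (fx (reflx p) p2)).
    by rewrite -[in LHS]hp /h' /= reflxK (th_VK H).
pose b t := k (reflx (g' t)).
have [cg g2 g0 g1 gth] := ga'.
have ab : angle_arc V b (fun t => 2 * pi - th' t).
  split.
  - move=> t; apply: (@ctn_comp _ _ _ (fun t => reflx (g' t)) k).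
      exact: (th_ctnV H).
    by apply: (@ctn_comp _ _ _ g' (@reflx R)) => //; exact: ctn_reflx.
  - move=> t; have /andP[y1 y2] := g2 t.
    have := @th_y R h k H (b t); rewrite /b (th_VK H) => -[][].
    + move=> h1 h2; have e : (reflx (g' t)).2 = 0 by apply: le_anti; rewrite h2.
      by have [_ ->] := @th_Vbot R h k H (reflx (g' t)) h2; rewrite e lexx ler01.
    + by move=> /andP[/ltW -> /ltW ->].
    + move=> h1 h2; have e : (reflx (g' t)).2 = 1 by apply: le_anti; rewrite h2 andbT.
      by have [_ ->] := @th_Vtop R h k H (reflx (g' t)) h2; rewrite e lexx ler01.
  - have [|_ ->] := @th_Vbot R h k H (reflx (g' 0)); by rewrite /= g0.
  - have [|_ ->] := @th_Vtop R h k H (reflx (g' 1)); by rewrite /= g1.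
  - move=> t t01; have [ct [r r0 e]] := gth _ t01; split.
      by apply: ctnD; [exact: ctn_cst|exact: ctnN].
    exists r => //; rewrite /V /b (th_VK H); move: e => [e1 e2].
    have c2 : cos (2 * pi - th' t) = cos (th' t).
      by rewrite -[RHS]cosN -[RHS]cosD2pi mulr2n; congr cos; ring.
    have s2 : sin (2 * pi - th' t) = - sin (th' t).
      by rewrite -[RHS]sinN -[RHS]sinD2pi mulr2n; congr sin; ring.
    rewrite c2 s2 mulrN -e1 -e2; apply: injective_projections => /=; ring.
have pp := pi_gt0 R.
have Vc p : ctn V p.
  have hc := @th_ctn _ _ _ H p.
  suff : ctn (fun p => ((h p).1 - p.1, (h p).2 - p.2)) p by [].
  ctn_tac.
have Vper x y : V (x + 1, y) = V (x, y).
  by rewrite /V (th_per H); apply: injective_projections => /=; ring.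
have Vbot x : (V (x, 0)).1 < 0 /\ (V (x, 0)).2 = 0.
  have [|v1 v2] := th_bot H (p := (x, 0)); first exact: lexx.
  by split; rewrite /V /= ?v2 ?subrr// subr_lt0.
have Vtop x : 0 < (V (x, 1)).1 /\ (V (x, 1)).2 = 0.
  have [|v1 v2] := th_top H (p := (x, 1)); first exact: lexx.
  by split; rewrite /V /= ?v2 ?subrr// subr_gt0.
have Veq0 p : 0 <= p.2 <= 1 -> V p = 0 <-> (kappa p.1 = 0 /\ p.2 = y0).
  move=> p2; split=> [/eqP|/(iffRL (fx p p2)) hp]; last by rewrite /V hp subrr.
  by rewrite subr_eq0 => /eqP; exact: (iffLR (fx p p2)).
have e0 : 2 * pi - th' 0 = pi by rewrite th0'; ring.
have := arc_final_angle_unique Vc Vper Vbot Vtop Veq0 kc k0 kp kq yi ga ab th0 e0.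
by rewrite th1 th1'; lra.
Qed.

End SingleFixedPoint.

(** * Two fixed points in the annulus *)

Theorem theorem2p1 (R : realType) (f : circle R * R -> circle R * R)
    (f_diffeo : C1_diffeo_annulus f)
    (f_boundary0 : f @` boundary 0 = boundary 0)
    (f_boundary1 : f @` boundary 1 = boundary 1)
    (f_twist : twist_map f)
    (f_invariant : exists dmu : circle R * R -> R,
        positive_integral_invariant f dmu) :
  exists p q : circle R * R,
    [/\ annulus p, annulus q, p <> q, f p = p & f q = q].
Proof.
apply: contrapT => unique.
have [g [fA gA fgK _ _]] := f_diffeo.
have [F Flift Ftwist] := f_twist.
have [dmu [dmu_int dmu_gt0 dmu_inv]] := f_invariant.
have [sF _ Fproj] := Flift.
have Fper := lift_degree Flift Ftwist.
have [h [k [H hF]]] : exists h k, twist_homeo h k /\ forall p, strip p -> h p = F p.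
  apply: (@extension R F) => //.
  - exact: lift_ctn Flift.
  - exact: (lift_inj fgK Flift Ftwist).
  - exact: (lift_surj gA fgK Flift Ftwist).
  - exact: (lift_bottom f_boundary0 Flift).
  - exact: (lift_top f_boundary1 Flift).
  - exact: (lift_mid fgK f_boundary0 f_boundary1 Flift).
have hS p : strip p -> strip (h p) by move=> sp; rewrite hF//; exact: sF.
have kS p : strip p -> strip (k p).
  move=> sp; have [q sq e] := lift_surj gA fgK Flift Ftwist sp.
  by rewrite -e -hF// (th_K H).
have image_eq (W : set (R * R)) :
    @annulus_proj R @` (h @` W `&` @strip R) = f @` (@annulus_proj R @` (W `&` @strip R)).
  apply/seteqP; split=> [_ [_ [[q Wq <-] sq] <-]|_ [_ [q [Wq sq] <-] <-]].
    have sq' : strip q by rewrite -(th_K H q); exact: kS.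
    by exists (annulus_proj q); [exists q|rewrite hF// Fproj].
  by exists (h q); [split; [exists q|exact: hS]|rewrite hF// Fproj].
have inv (W : set (R * R)) : open W ->
    (\int[@annulus_measure R]_(p in @annulus_proj R @` (W `&` @strip R)) (dmu p)%:E =
     \int[@annulus_measure R]_(p in @annulus_proj R @` (h @` W `&` @strip R)) (dmu p)%:E)%E.
  move=> oW; rewrite image_eq; apply: dmu_inv; first exact: measurable_annulus_image.
  by move=> _ [q [_ sq] <-].
have nh : nondissipative h.
  apply: (nondissipative_of_invariant (th_K H) (th_VK H) (th_ctnV H) (th_per H)
    dmu_int dmu_gt0) => W oW _; exact: inv.
have nk : nondissipative k.
  apply: (nondissipative_of_invariant (th_VK H) (th_K H) (th_ctn H) (th_Vper H)
    dmu_int dmu_gt0) => W oW _.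
  have hkW : h @` (k @` W) = W.
    apply/seteqP; split=> [_ [_ [q Wq <-] <-]|q Wq]; first by rewrite (th_VK H).
    by exists (k q); [exists q|rewrite (th_VK H)].
  have oW' : open (k @` W) by exact: (open_image (th_VK H) (th_K H) (th_ctn H)).
  by have := inv _ oW'; rewrite hkW.
have [kappa [x0 [y0 [xc dat]]]] : exists kappa x0 y0 xc, fixed_point_data h kappa x0 y0 xc.
  apply: (at_most_one_data H) => p q sp sq hp hq.
  apply/annulus_projP; apply: contrapT => pq; apply: unique.
  exists (annulus_proj p), (annulus_proj q); split=> //.
    by rewrite -Fproj// -hF// hp.
  by rewrite -Fproj// -hF// hq.
exact: (single_fixed_point_absurd H nh nk dat).
Qed.
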